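(* Let $k$ be a positive integer. If $H_1, H_2, \dots$ is a convergent sequence of $k$-uniform hypergraphs, then there exists a $k$-uniform hypergraphon $W$ such that $t(F,H_n) \to t(F,W)$ as $n \to \infty$ for every $k$-uniform hypergraph $F$.
   Context: All hypergraphs are finite; a $k$-uniform hypergraph $F$ is a collection of $k$-element subsets (edges) of a finite vertex set $V(F)$, and its edge set is $E(F)$. All sets and functions are assumed measurable. For $k$-uniform hypergraphs $F$ and $H$, $\hom(F,H)$ is the number of maps $V(F)\to V(H)$ that carry every edge of $F$ to an edge of $H$, and $t(F,H) := \hom(F,H)/|V(H)|^{|V(F)|}$. A sequence $H_1,H_2,\dots$ of $k$-uniform hypergraphs is convergent if the sequence of numbers $t(F,H_1), t(F,H_2),\dots$ converges for every $k$-uniform hypergraph $F$. For a set $A$, $r(A)$ is the collection of all nonempty subsets of $A$, $r_<(A)$ is the collection of all nonempty proper subsets of $A$, and $r(A,m)$ is the collection of all nonempty subsets of $A$ of size at most $m$. Write $[k]=\{1,\dots,k\}$, $r[k]=r([k])$, $r_<[k]=r_<([k])$. If $\mathbf{x}=(x_A : A\in\mathcal{A})\in[0,1]^{\mathcal{A}}$ and $\mathcal{B}\subseteq\mathcal{A}$, then $\mathbf{x}_{\mathcal{B}}=(x_B: B\in\mathcal{B})$. A $k$-uniform hypergraphon is a measurable function $W\colon [0,1]^{r_<[k]}\to[0,1]$ that is symmetric, i.e. invariant under every permutation of the coordinates (indexed by $r_<[k]$) induced by a permutation of $[k]$. For a $k$-uniform hypergraph $F$ and a $k$-uniform hypergraphon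 $W$, $$t(F,W) := \int_{[0,1]^{r(V(F),k-1)}} \prod_{A\in E(F)} W(\mathbf{x}_{r_<(A)})\,d\mathbf{x},$$ where for an edge $A$ with $|A|=k$ the function $W$ is evaluated by identifying $A$ with $[k]$ by any bijection (the choice is immaterial by symmetry). *)

(* Defs.v *)
From HB Require Import structures.
From mathcomp Require Import all_boot all_order all_algebra all_fingroup.
From mathcomp Require Import all_classical all_reals all_analysis.

Set Implicit Arguments.
Unset Strict Implicit.
Unset Printing Implicit Defensive.

Import Order.TTheory GRing.Theory Num.Theory.
Import numFieldNormedType.Exports.

Local Open Scope classical_set_scope.
Local Open Scope ring_scope.

Record hypergraph (k : nat) := Hypergraph {
  vert : finType ;
  edges : {set {set vert}} ;
  edges_card : forall A, A \in edges -> #|A| = k }.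

Definition num_hom (k : nat) (F H : hypergraph k) : nat :=
  #|[set f : {ffun vert F -> vert H} | [forall A in edges F, f @: A \in edges H]]%SET|.

(* If [vert H] is empty this is [0 / 0 = 0] for nonempty [vert F]; the
   mathematical quantity is only defined for nonempty [vert H]. *)
Definition hom_density (R : realType) (k : nat) (F H : hypergraph k) : R :=
  (num_hom F H)%:R / (#|vert H| ^ #|vert F|)%:R.

Definition convergent (R : realType) (k : nat) (H : nat -> hypergraph k) : Prop :=
  forall F : hypergraph k, cvgn (fun n => hom_density R F (H n)).

(* [r_<(A)] and [r(A, m)] *)
Definition rproper (T : finType) (A : {set T}) : {set {set T}} :=
  [set B : {set T} | (B != finset.set0) && (B \proper A)]%SET.

Definition rle (T : finType) (A : {set T}) (m : nat) : {set {set T}} :=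
  [set B : {set T} | [&& B != finset.set0, B \subset A & (#|B| <= m)%N]]%SET.

(* The space [R^I], with the product of the Borel sigma-algebras. *)
Definition point (R : realType) (I : finType) : Type :=
  {ffun I -> measurableTypeR R}.

Definition point_display : measure_display. Proof. exact. Qed.

Section point_measurable.
Variables (R : realType) (I : finType).

HB.instance Definition _ := Choice.on (point R I).
HB.instance Definition _ :=
  isPointed.Build (point R I) ([ffun=> 0] : {ffun I -> measurableTypeR R}).

Definition point_measurable : set (set (point R I)) :=
  <<s \bigcup_i preimage_set_system setT (fun x : point R I => x i) measurable >>.

HB.instance Definition _ := @isMeasurable.Build point_display (point R I)
  point_measurable (@sigma_algebra0 _ _ _) (@sigma_algebraC _ _)
  (@sigma_algebra_bigcup _ _ _).

End point_measurable.

Section cube_measure.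
Variable R : realType.

Let T := measurableTypeR R.

Definition cons_pair (n : nat) (p : T * n.-tuple T) : n.+1.-tuple T :=
  [tuple of p.1 :: p.2].

Lemma measurable_cons_pair n : measurable_fun [set: T * n.-tuple T] (@cons_pair n).
Proof. exact: measurable_cons. Qed.

HB.instance Definition _ n :=
  isMeasurableFun.Build _ _ _ _ (@cons_pair n) (@measurable_cons_pair n).

(* The [n]-fold product of the uniform probability on [[0, 1]]. *)
Fixpoint tuple_uniform (n : nat) : probability (n.-tuple T) R :=
  match n with
  | 0 => \d_ [tuple]
  | m.+1 => distribution
              (uniform_prob (@ltr01 R) \x tuple_uniform m)%E (@cons_pair m)
  end.

Lemma tuple_uniform_box n (A : 'I_n -> set T) : (forall i, measurable (A i)) ->
  (tuple_uniform n [set t | forall i, A i (tnth t i)]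
   = \prod_(i < n) uniform_prob (@ltr01 R) (A i))%E.
Proof.
elim: n A => [|n IH] A mA /=.
  rewrite big_ord0 diracE mem_set//= => -[].
  by case.
rewrite big_ord_recl -(IH (fun i => A (lift ord0 i)))//.
rewrite /distribution /pushforward.
rewrite [X in product_measure1 _ _ X](_ : _ =
    A ord0 `*` [set t | forall i, A (lift ord0 i) (tnth t i)]); last first.
  apply/seteqP; split=> -[x t] /=.
    move=> h; split; first exact: (h ord0).
    by move=> i; have := h (lift ord0 i); rewrite tnthS.
  move=> [h0 h] i; case: (unliftP ord0 i) => [j ->|->//].
  by rewrite tnthS.
rewrite product_measure1E//.
rewrite [X in measurable X](_ : _ =
    \bigcap_(i in [set: 'I_n]) ((@tnth _ T ^~ i) @^-1` A (lift ord0 i))).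
  apply: fin_bigcap_measurable => // i _.
  by rewrite -[X in measurable X]setTI; exact: measurable_tnth.
by apply/seteqP; split=> t /= h i; [move=> _|]; apply: h.
Qed.

Variable I : finType.

Definition point_of_tuple (t : #|I|.-tuple T) : point R I :=
  [ffun i => tnth t (enum_rank i)].

Lemma measurable_point_of_tuple :
  measurable_fun [set: #|I|.-tuple T] point_of_tuple.
Proof.
apply: (@measurability _ _ _ _ _ _
  (\bigcup_i preimage_set_system setT (fun x : point R I => x i) measurable)) => //.
move=> _ [_ [i _ [A mA <-]] <-].
rewrite !setTI [X in measurable X](_ : _ = (@tnth _ T ^~ (enum_rank i)) @^-1` A).
  by rewrite -[X in measurable X]setTI; exact: measurable_tnth.
by apply/seteqP; split=> t /=; rewrite ffunE.
Qed.

HB.instance Definition _ :=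
  isMeasurableFun.Build _ _ _ _ point_of_tuple measurable_point_of_tuple.

(* Lebesgue measure on [[0, 1]^I], as a probability on [R^I]. *)
Definition cube_uniform : probability (point R I) R :=
  distribution (tuple_uniform #|I|) point_of_tuple.

Lemma cube_uniform_box (A : I -> set T) :
  (forall i, measurable (A i)) ->
  (cube_uniform [set x | forall i, A i (x i)]
   = \prod_i uniform_prob (@ltr01 R) (A i))%E.
Proof.
move=> mA; rewrite [RHS](reindex (@enum_val I predT)) /=; last first.
  by exists enum_rank => i _; rewrite ?enum_valK ?enum_rankK.
rewrite -tuple_uniform_box //= /distribution /pushforward; congr (tuple_uniform _ _).
apply/seteqP; split=> t /= h i.
  by have := h (enum_val i); rewrite ffunE enum_valK.
by rewrite ffunE; have := h (enum_rank i); rewrite enum_rankK.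
Qed.

Definition cube : set (point R I) := [set x | forall i, x i \in `[0, 1]].

End cube_measure.

Section hypergraphon.
Variables (R : realType) (k : nat).

Definition rk : finType := {B : {set 'I_k} | B \in rproper [set: 'I_k]%SET}.

Lemma perm_rproper (s : {perm 'I_k}) (B : rk) :
  s @: val B \in rproper [set: 'I_k]%SET.
Proof.
have := valP B; rewrite !inE imset_eq0 !properT => /andP[-> /=].
by apply: contra => /eqP sB; rewrite eqEcard finset.subsetT /=
  -(card_imset (val B) (@perm_inj _ s)) sB.
Qed.

Definition perm_rk (s : {perm 'I_k}) (B : rk) : rk := Sub (s @: val B) (perm_rproper s B).

Definition perm_point (s : {perm 'I_k}) (x : point R rk) : point R rk :=
  [ffun B => x (perm_rk s B)].

(* [W] is a function on all of [R^(r_<[k])]; only its restriction to the cube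
   is constrained or used. *)
Record hypergraphon := Hypergraphon {
  hypergraphon_fun :> point R rk -> R ;
  hypergraphon_measurable :
    measurable_fun (@cube R rk) (hypergraphon_fun : _ -> measurableTypeR R) ;
  hypergraphon_itv : forall x, cube x -> hypergraphon_fun x \in `[0, 1] ;
  hypergraphon_sym : forall (s : {perm 'I_k}) x, cube x ->
    hypergraphon_fun (perm_point s x) = hypergraphon_fun x }.

Variable F : hypergraph k.

Definition edge : finType := {A : {set vert F} | A \in edges F}.

Definition rvert : finType :=
  {B : {set vert F} | B \in rle [set: vert F]%SET k.-1}.

(* The enumeration of an edge identifies it with [[k]]. *)
Definition edge_label (A : edge) (i : 'I_k) : vert F :=
  enum_val (cast_ord (esym (edges_card (valP A))) i).

Lemma edge_label_rle (A : edge) (B : rk) :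
  edge_label A @: val B \in rle [set: vert F]%SET k.-1.
Proof.
have := valP B; rewrite !inE imset_eq0 finset.subsetT /= => /andP[-> /proper_card].
rewrite cardsT card_ord => Bk /=.
apply: leq_trans (leq_imset_card _ _) _.
by rewrite -ltnS (ltn_predK Bk).
Qed.

Definition sub_edge (A : edge) (B : rk) : rvert :=
  Sub (edge_label A @: val B) (edge_label_rle A B).

(* The subvector [x_(r_<(A))], reindexed by [r_<[k]]. *)
Definition restrict (A : edge) (x : point R rvert) : point R rk :=
  [ffun B => x (sub_edge A B)].

Definition hypergraphon_density (W : hypergraphon) : R :=
  (\int[cube_uniform R rvert]_(x in @cube R rvert)
     \prod_(A : edge) W (restrict A x))%R.

End hypergraphon.

(* Main.v *)
From HB Require Import structures.
From mathcomp Require Import all_boot all_order all_algebra all_fingroup finmap.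
From mathcomp Require Import all_classical all_reals all_analysis.
From mathcomp Require Import measurable_realfun ring lra.
Require Import Defs.

(** A convergent sequence determines, for every finite set [U], the limiting law of the
    hypergraph on [U] obtained by pulling [H n] back along a uniform random map from [U] to the
    vertices of [H n]. These laws are consistent under injections, and the density of [F] in
    [H n] tends to the probability that all the edges of [F] are present. What has to be shown
    is thus a representation theorem of Aldous-Hoover type: the limiting random hypergraph
    arises from independent uniform variables [x B] attached to the nonempty sets [B] of fewer
    than [k] vertices.

    The randomness is found in the sample itself. Besides the vertices [V] of interest, sample
    [M] spare vertices. As [M] grows, the edges that meet [V] exactly in [B] form an infinite
    sequence of bits, the colour of [B]. The key fact is [conditional_independence]: given the
    colours of the proper subsets of [B] and its own earlier bits, a bit of the colour
    of [B] is asymptotically independent of the colours of all the sets that do not contain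
    [B]. Indeed an injection that fixes [B] and the spare vertices and moves [V :\: B] to new
    spare vertices transforms any predictor of the bit from all these colours into a
    predictor from the former ones, with the same squared error. Only finite sums occur
    in this argument.

    Hence the colours can be sampled one bit after the other. The probability [bit_prob] of the
    next bit given the past is the limit of finite conditional probabilities, and a single
    uniform variable [x B] produces the whole colour of [B] by arithmetic coding
    ([coder], [model]). That the colours so constructed have the right joint law
    ([agree_lower_set]) is proved by adding one bit at a time: [fresh_bit] replaces the new
    bit by its conditional probability in the model, and [bit_prob_step] replaces this
    probability by the bit in the limiting law. For sets of [k] vertices the conditional
    probability is kept and not sampled. It is a function of the coordinates of the proper
    subsets, and by [Ex_weight] the limiting density of [F] is the mean of the product of
    these functions over the edges of [F].

    This would be the hypergraphon, but for one extra coordinate, that of the empty set. Limits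
    of densities are multiplicative on disjoint unions, so that the density obtained by
    fixing this coordinate has mean [t] and second moment [t ^+ 2], where [t] is the limiting
    density of [F]: almost every value of the coordinate gives density [t]. There are countably
    many [F] up to isomorphism, so one value is good for all of them. *)

Set Implicit Arguments.
Unset Strict Implicit.
Unset Printing Implicit Defensive.

Import Order.TTheory GRing.Theory Num.Theory.
Import numFieldNormedType.Exports.

Local Open Scope classical_set_scope.
Local Open Scope ring_scope.

(** * Sampling a hypergraph along a random map *)

Definition pullback (U V : finType) (tau : U -> V) (T : {set {set V}}) :
  {set {set U}} := [set A : {set U} | tau @: A \in T]%SET.

Definition pull_edges (k : nat) (X : hypergraph k) (U : finType)
    (phi : {ffun U -> vert X}) : {set {set U}} :=
  [set A : {set U} | (#|A| == k) && (phi @: A \in edges X)]%SET.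

(** The law of the pullback of [X] along a uniform random map, injective or not: with
    all maps allowed, hypergraphs of bounded order need no special treatment. *)
Definition freq (R : realType) (k : nat) (X : hypergraph k) (U : finType)
    (S : {set {set U}}) : R :=
  #|[set phi : {ffun U -> vert X} | pull_edges phi == S]%SET|%:R
    / (#|vert X| ^ #|U|)%:R.

Lemma card_ffun_extension (U V X : finType) (tau : U -> V) (phi : {ffun U -> X}) :
  injective tau ->
  #|[set psi : {ffun V -> X} | [ffun u => psi (tau u)] == phi]%SET|
  = (#|X| ^ (#|V| - #|U|))%N.
Proof.
move=> tau_inj.
pose F v : pred X :=
  if [pick u | tau u == v] is Some u then pred1 (phi u) else predT.
rewrite (_ : #|_| = #|(family F : simpl_pred {ffun V -> X})|); last first.
  apply: eq_card => psi; rewrite inE; apply/eqP/familyP => [h v|h].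
    rewrite /F; case: pickP => [u /eqP <-|//].
    by rewrite -h ffunE inE.
  apply/ffunP => u; rewrite ffunE; have := h (tau u).
  rewrite /F; case: pickP => [u' /eqP/tau_inj ->|/(_ u)]; last by rewrite eqxx.
  by rewrite inE => /eqP.
rewrite card_family foldrE big_map big_enum /=.
rewrite (bigID (mem (codom tau))) /= big1 ?mul1n; last first.
  move=> v /codomP[u ->]; rewrite /F; case: pickP => [u' _|/(_ u)].
    by rewrite card1.
  by rewrite eqxx.
rewrite (eq_bigr (fun=> #|X|)); last first.
  move=> v vN; rewrite /F; case: pickP => [u /eqP uv|_]; last by rewrite cardT.
  by rewrite -uv codom_f in vN.
rewrite prod_nat_const; congr (_ ^ _)%N.
rewrite -(card_codom tau_inj) -(cardC (mem (codom tau))) addKn.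
by apply: eq_card.
Qed.

Section frequencies.
Variables (R : realType) (k : nat) (X : hypergraph k).
Hypothesis X0 : (0 < #|vert X|)%N.

Lemma freq_ge0 (U : finType) (S : {set {set U}}) : 0 <= freq R X S.
Proof. by rewrite /freq divr_ge0. Qed.

Lemma sum_freq (U : finType) (P : pred {set {set U}}) :
  \sum_(S | P S) freq R X S =
  #|[set phi : {ffun U -> vert X} | P (pull_edges phi)]%SET|%:R
    / (#|vert X| ^ #|U|)%:R.
Proof.
rewrite /freq -mulr_suml -natr_sum; congr (_%:R / _).
rewrite -sum1_card (partition_big (@pull_edges k X U) P) /=; last first.
  by move=> phi; rewrite inE.
apply: eq_bigr => S PS; rewrite -sum1_card; apply: eq_bigl => phi.
by rewrite !inE; case: eqP => [->|]; rewrite ?PS ?andbF.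
Qed.

Lemma freq_sum1 (U : finType) : \sum_S freq R X (S : {set {set U}}) = 1.
Proof.
rewrite sum_freq (_ : [set _ | _]%SET = [set: {ffun U -> vert X}]%SET).
  by rewrite cardsT card_ffun divff// pnatr_eq0 expn_eq0 negb_and -lt0n X0.
by apply/setP => phi; rewrite !inE.
Qed.

Lemma pull_edges_pullback (U V : finType) (tau : U -> V)
    (psi : {ffun V -> vert X}) : injective tau ->
  pull_edges [ffun u => psi (tau u)] = pullback tau (pull_edges psi).
Proof.
move=> tau_inj; apply/setP => A; rewrite !inE card_imset//; congr (_ && _).
rewrite (_ : _ @: A = psi @: (tau @: A))%SET//.
by rewrite -imset_comp; apply: finset.eq_imset => u; rewrite ffunE.
Qed.

(** The restriction of a uniform random map along an injection is again uniform, since all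
    its fibres have the same cardinality. *)
Lemma freq_pullback (U V : finType) (tau : U -> V) (S : {set {set U}}) :
  injective tau ->
  freq R X S = \sum_(T | pullback tau T == S) freq R X T.
Proof.
move=> tau_inj; have leUV : (#|U| <= #|V|)%N := leq_card _ tau_inj.
rewrite sum_freq /freq -{1}(subnK leUV) expnD.
rewrite (_ : #|[set phi | pullback tau (pull_edges phi) == S]%SET| =
  #|vert X| ^ (#|V| - #|U|) *
  #|[set phi : {ffun U -> vert X} | pull_edges phi == S]%SET|)%N.
  rewrite !natrM -mulf_div divff ?mul1r//.
  by rewrite pnatr_eq0 expn_eq0 negb_and -lt0n X0.
rewrite mulnC -sum_nat_const -sum1_card.
rewrite (partition_big (fun psi : {ffun V -> vert X} => [ffun u => psi (tau u)])
  (mem [set phi : {ffun U -> vert X} | pull_edges phi == S]%SET)) /=; last first.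
  by move=> psi; rewrite !inE pull_edges_pullback.
apply: eq_bigr => phi; rewrite inE => /eqP phiS.
rewrite -(card_ffun_extension phi tau_inj) -sum1_card; apply: eq_bigl => psi.
rewrite !inE -pull_edges_pullback//.
case: (_ =P phi) => [->|]; last by rewrite andbF.
by rewrite phiS eqxx.
Qed.

Lemma sum_freq_superset (F : hypergraph k) :
  \sum_(S : {set {set vert F}} | edges F \subset S) freq R X S
  = hom_density R F X.
Proof.
rewrite sum_freq /hom_density /num_hom; congr (_%:R / _); apply: eq_card => phi.
rewrite !inE; apply/fintype.subsetP/forall_inP => h A AF.
  by have := h A AF; rewrite inE => /andP[].
by rewrite inE (edges_card AF) eqxx h.
Qed.

(** A uniform random map on a disjoint union is a pair of independent uniform random maps. *)
Lemma freq_disjoint_union (F : hypergraph k) :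
  \sum_(T : {set {set (vert F + vert F)}} |
     [forall A in edges F, (inl @: (A : {set _}) \in T)
                           && (inr @: (A : {set _}) \in T)]) freq R X T
  = hom_density R F X ^+ 2.
Proof.
rewrite sum_freq /hom_density card_sum expnD natrM expr2 mulf_div -!natrM.
congr (_%:R / _); rewrite /num_hom.
set D := [set f : {ffun _ -> _} | _]%SET.
rewrite -cardsX -[RHS](@card_imset _ _
  (fun p : {ffun vert F -> vert X} * {ffun vert F -> vert X} =>
    [ffun s => match s with inl v => p.1 v | inr v => p.2 v end])); last first.
  move=> [p1 p2] [q1 q2] /= /ffunP pq; congr (_, _); apply/ffunP => v.
    by have := pq (inl v); rewrite !ffunE.
  by have := pq (inr v); rewrite !ffunE.
apply: eq_card => phi; rewrite inE; apply/forall_inP/imsetP => [h|].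
  exists ([ffun v => phi (inl v)], [ffun v => phi (inr v)]); last first.
    by apply/ffunP => -[v|v]; rewrite !ffunE.
  rewrite !inE /=; apply/andP; split; apply/forall_inP => A /h /andP[].
    rewrite inE -imset_comp => /andP[_ +] _.
    rewrite (_ : _ @: A = [ffun v => phi (inl v)] @: A)%SET//.
    by apply: finset.eq_imset => v /=; rewrite ffunE.
  rewrite [in X in _ -> X -> _]inE -imset_comp => _ /andP[_].
  rewrite (_ : _ @: A = [ffun v => phi (inr v)] @: A)%SET//.
  by apply: finset.eq_imset => v /=; rewrite ffunE.
move=> [[p1 p2]]; rewrite !inE /= => /andP[/forall_inP h1 /forall_inP h2] -> A AF.
rewrite !inE !card_imset; [|by move=> ? ? []..].
rewrite (edges_card AF) eqxx /= -!imset_comp; apply/andP; split.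
  rewrite (_ : _ @: _ = p1 @: A)%SET ?h1//.
  by apply: finset.eq_imset => v /=; rewrite ffunE.
rewrite (_ : _ @: _ = p2 @: A)%SET ?h2//.
by apply: finset.eq_imset => v /=; rewrite ffunE.
Qed.

Lemma freq_nonuniform (U : finType) (E : {set {set U}}) A :
  A \in E -> #|A| != k ->
  \sum_(S : {set {set U}} | E \subset S) freq R X S = 0.
Proof.
move=> AE Ak; rewrite sum_freq (_ : [set _ | _]%SET = finset.set0) ?cards0 ?mul0r//.
apply/setP => phi; rewrite !inE; apply/negP => /fintype.subsetP/(_ _ AE).
by rewrite inE (negbTE Ak).
Qed.

End frequencies.

Lemma cvgn_sum (R : realType) (I : finType) (P : pred I) (u : I -> nat -> R)
    (l : I -> R) : (forall i, P i -> u i @ \oo --> l i) ->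
  (fun n => \sum_(i | P i) u i n) @ \oo --> \sum_(i | P i) l i.
Proof.
by move=> ul; apply: cvg_big => //; apply: pseudometric_normed_Zmodule.add_continuous.
Qed.

(** The laws of a random set system on all finite vertex sets, consistent under injections:
    permutation invariance and restriction to a subset in one axiom. *)
Record exchangeable_law (R : realType) := ExchangeableLaw {
  law :> forall V : finType, {set {set V}} -> R ;
  law_ge0 : forall (V : finType) (S : {set {set V}}), 0 <= law S ;
  law_sum1 : forall V : finType, \sum_S law (S : {set {set V}}) = 1 ;
  law_pullback : forall (U V : finType) (tau : U -> V) (S : {set {set U}}),
    injective tau -> law S = \sum_(T | pullback tau T == S) law T }.

Arguments law {R} _ {V}.

Definition mean (R : realType) (L : exchangeable_law R) (V : finType)
    (g : {set {set V}} -> R) : R := \sum_S law L S * g S.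

(** The probability that all the sets of [E] are present. *)
Definition density (R : realType) (L : exchangeable_law R) (V : finType)
    (E : {set {set V}}) : R := \sum_(S : {set {set V}} | E \subset S) law L S.

Section limit_law.
Variables (R : realType) (k : nat) (H : nat -> hypergraph k).
Hypothesis vert_gt0 : forall n, (0 < #|vert (H n)|)%N.
Hypothesis cvgH : convergent R H.

Lemma is_cvg_freq_superset (U : finType) (E : {set {set U}}) :
  cvgn (fun n => \sum_(S : {set {set U}} | E \subset S) freq R (H n) S).
Proof.
have [/forall_inP/= hE|/forall_inPn[A AE Ak]] :=
    boolP [forall A in E, #|A| == k].
  have hE' A : A \in E -> #|A| = k by move=> /hE /eqP.
  have := @cvgH (Hypergraph hE').
  by under eq_fun do rewrite -sum_freq_superset.
under eq_fun do rewrite (freq_nonuniform R (H _) AE Ak).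
exact: is_cvg_cst.
Qed.

(** Convergence is assumed for upper sets of set systems only. The frequency of a single
    [S] is the frequency of the systems containing [S] minus those strictly containing it,
    whence a downward induction. *)
Lemma is_cvg_freq (U : finType) (S : {set {set U}}) :
  cvgn (fun n => freq R (H n) S).
Proof.
have [m] := ubnP #|~: S|; elim: m S => // m IH S Sm.
have -> : (fun n => freq R (H n) S) = (fun n =>
    \sum_(T : {set {set U}} | S \subset T) freq R (H n) T -
    \sum_(T : {set {set U}} | S \proper T) freq R (H n) T).
  apply/funext => n; rewrite (bigD1 S) //= -addrA.
  rewrite (eq_bigl (fun T : {set {set U}} => S \proper T)) ?subrr ?addr0//.
  by move=> T; rewrite finset.properEneq eq_sym andbC.
apply: is_cvgB; first exact: is_cvg_freq_superset.
apply/cvg_ex; eexists; apply: cvgn_sum => T ST; apply: IH.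
rewrite -ltnS; apply: leq_trans Sm; rewrite ltnS.
by apply: proper_card; rewrite finset.properC.
Qed.

Definition limit_freq (U : finType) (S : {set {set U}}) : R :=
  limn (fun n => freq R (H n) S).

Lemma cvg_sum_freq (U : finType) (P : pred {set {set U}}) :
  (fun n => \sum_(S | P S) freq R (H n) S) @ \oo -->
  \sum_(S | P S) limit_freq S.
Proof. by apply: cvgn_sum => S _; exact: is_cvg_freq. Qed.

Lemma limit_freq_ge0 (U : finType) (S : {set {set U}}) : 0 <= limit_freq S.
Proof.
apply: limr_ge; first exact: is_cvg_freq.
by apply: nearW => n; exact: freq_ge0.
Qed.

Lemma limit_freq_sum1 (U : finType) : \sum_S limit_freq (S : {set {set U}}) = 1.
Proof.
have h := @cvg_sum_freq U predT.
rewrite (_ : (fun n => _) = fun=> 1) in h; last first.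
  by apply/funext => n; rewrite freq_sum1.
exact: (norm_cvg_unique h (cvg_cst _)).
Qed.

Lemma limit_freq_pullback (U V : finType) (tau : U -> V) (S : {set {set U}}) :
  injective tau -> limit_freq S = \sum_(T | pullback tau T == S) limit_freq T.
Proof.
move=> tau_inj; have h : (fun n => freq R (H n) S) @ \oo --> limit_freq S.
  exact: is_cvg_freq.
apply: (norm_cvg_unique h).
rewrite (_ : (fun n => _) =
    (fun n => \sum_(T | pullback tau T == S) freq R (H n) T)).
  exact: cvg_sum_freq.
by apply/funext => n; rewrite (freq_pullback R (vert_gt0 _) S tau_inj).
Qed.

Definition limit_law : exchangeable_law R :=
  ExchangeableLaw limit_freq_ge0 limit_freq_sum1 limit_freq_pullback.

Lemma cvg_hom_density (F : hypergraph k) :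
  (fun n => hom_density R F (H n)) @ \oo --> density limit_law (edges F).
Proof.
rewrite (_ : (fun n => _) = (fun n =>
    \sum_(S : {set {set vert F}} | edges F \subset S) freq R (H n) S)).
  exact: cvg_sum_freq.
by apply/funext => n; rewrite sum_freq_superset.
Qed.

(** Disjoint parts of the sample are independent: this is what makes the coordinate of the
    empty set superfluous in the end. *)
Lemma limit_law_dissociated (F : hypergraph k) :
  \sum_(T : {set {set (vert F + vert F)}} |
     [forall A in edges F, (inl @: (A : {set _}) \in T)
                           && (inr @: (A : {set _}) \in T)]) law limit_law T
  = density limit_law (edges F) ^+ 2.
Proof.
have h := @cvg_sum_freq (vert F + vert F)%type (fun T =>
  [forall A in edges F, (inl @: (A : {set _}) \in T)
                        && (inr @: (A : {set _}) \in T)]).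
apply: (norm_cvg_unique h).
rewrite (_ : (fun n => _) = (fun n => hom_density R F (H n) ^+ 2)).
  by rewrite expr2; apply: cvgM; exact: cvg_hom_density.
by apply/funext => n; rewrite freq_disjoint_union.
Qed.

End limit_law.

(** * Conditional expectations over finite probability spaces *)

Section finite_conditioning.
Variables (R : realType) (T T' : finType) (p f : T -> R) (l : T -> T').
Hypothesis p_ge0 : forall s, 0 <= p s.

(** The conditional expectation of [f] given the label [l], as a function of the value of
    the label; the value at a label of probability zero is the junk value 0. *)
Definition cond (c : T') : R :=
  (\sum_(s | l s == c) p s * f s) / (\sum_(s | l s == c) p s).

Lemma cond_orth (g : T' -> R) :
  \sum_s p s * ((f s - cond (l s)) * g (l s)) = 0.
Proof.
rewrite (partition_big l predT) //= big1// => c _.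
rewrite (eq_bigr (fun s => (p s * f s - cond c * p s) * g c)); last first.
  by move=> s /eqP <-; ring.
rewrite -mulr_suml sumrB -mulr_sumr /cond.
have [p0|p0] := eqVneq (\sum_(s | l s == c) p s) 0; last first.
  by rewrite divfK// subrr mul0r.
rewrite p0 mulr0 big1 ?subr0 ?mul0r// => s sc.
have /psumr_eq0P/(_ s sc) -> : \sum_(s | l s == c) p s = 0 by [].
  by rewrite mul0r.
by [].
Qed.

Lemma cond_pythagoras (g : T' -> R) :
  \sum_s p s * (cond (l s) - g (l s)) ^+ 2 =
  \sum_s p s * (f s - g (l s)) ^+ 2 - \sum_s p s * (f s - cond (l s)) ^+ 2.
Proof.
have h := cond_orth (fun c => 2 * (cond c - g c)).
apply/eqP; rewrite -subr_eq0 -sumrB -sumrB -[X in _ == X]oppr0 -[X in - X]h -sumrN.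
by apply/eqP; apply: eq_bigr => s _; ring.
Qed.

Lemma cond_min (g : T' -> R) :
  \sum_s p s * (f s - cond (l s)) ^+ 2 <= \sum_s p s * (f s - g (l s)) ^+ 2.
Proof.
rewrite -subr_ge0 -cond_pythagoras sumr_ge0// => s _.
by rewrite mulr_ge0 ?sqr_ge0.
Qed.

Lemma cond_itv (c : T') : (forall s, 0 <= f s <= 1) -> 0 <= cond c <= 1.
Proof.
move=> f01; have s0 : 0 <= \sum_(s | l s == c) p s by rewrite sumr_ge0.
rewrite /cond divr_ge0//=; last first.
  by rewrite sumr_ge0// => s _; rewrite mulr_ge0//; case/andP: (f01 s).
have [->|p0] := eqVneq (\sum_(s | l s == c) p s) 0; first by rewrite invr0 mulr0.
rewrite ler_pdivrMr ?lt0r ?p0// mul1r ler_sum// => s _.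
by rewrite ler_piMr//; case/andP: (f01 s).
Qed.

End finite_conditioning.

Section mean.
Variables (R : realType) (L : exchangeable_law R).

(** Every use of exchangeability goes through this change of variables. *)
Lemma mean_pullback (U V : finType) (tau : U -> V) (g : {set {set U}} -> R) :
  injective tau -> mean L g = mean L (fun T => g (pullback tau T)).
Proof.
move=> tau_inj; rewrite /mean [RHS](partition_big (pullback tau) predT)//=.
apply: eq_bigr => S _; rewrite (law_pullback L S tau_inj) mulr_suml.
by apply: eq_bigr => T /eqP ->.
Qed.

Lemma le_mean (V : finType) (g h : {set {set V}} -> R) :
  (forall S, g S <= h S) -> mean L g <= mean L h.
Proof. by move=> gh; apply: ler_sum => S _; rewrite ler_wpM2l// law_ge0. Qed.

Lemma mean_cst (V : finType) (c : R) : mean L (fun _ : {set {set V}} => c) = c.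
Proof. by rewrite /mean -mulr_suml law_sum1 mul1r. Qed.

Lemma meanD (V : finType) (g h : {set {set V}} -> R) :
  mean L (fun S => g S + h S) = mean L g + mean L h.
Proof. by rewrite /mean -big_split; apply: eq_bigr => S _ /=; rewrite mulrDr. Qed.

Lemma meanZ (V : finType) (c : R) (g : {set {set V}} -> R) :
  mean L (fun S => c * g S) = c * mean L g.
Proof. by rewrite /mean mulr_sumr; apply: eq_bigr => S _; rewrite mulrCA. Qed.

Lemma meanB (V : finType) (g h : {set {set V}} -> R) :
  mean L (fun S => g S - h S) = mean L g - mean L h.
Proof. by rewrite /mean -sumrB; apply: eq_bigr => S _ /=; rewrite mulrBr. Qed.

End mean.

(** * Colours: the edges through a set of base vertices *)

(** Sets of spare vertices are numbered independently of how many spare vertices there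
    are. The empty set gets the number 0: then a set of base vertices, which as an edge
    uses no spare vertex, is its own first bit and has no earlier bits. *)
Definition spare_code (M : nat) (C : {set 'I_M}) : nat :=
  if C == finset.set0 then 0%N
  else (choice.pickle (enum_fset [fset val c | c in C]%fset)).+1.

Lemma spare_code_inj M : injective (@spare_code M).
Proof.
move=> C D; rewrite /spare_code; case: eqP => [->|_]; case: eqP => [->|_]//.
move=> [] /(pcan_inj (@choice.pickleK _)) /val_inj /fsetP CD; apply/setP => c.
have /= := CD (val c); rewrite !mem_imfset//=; exact: val_inj.
Qed.

Lemma spare_code_imset M M' (h : 'I_M -> 'I_M') (C : {set 'I_M}) :
  (forall c, h c = c :> nat) -> spare_code (h @: C) = spare_code C.
Proof.
move=> hE; rewrite /spare_code imset_eq0; case: eqP => // _.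
congr (choice.pickle (enum_fset _)).+1; apply/fsetP => x.
apply/imfsetP/imfsetP => -[c /= cC ->].
  by move/imsetP: cC => [d dC ->]; exists d => //; rewrite hE.
by exists (h c); rewrite ?imset_f// hE.
Qed.

Lemma spare_code0 M : spare_code (finset.set0 : {set 'I_M}) = 0%N.
Proof. by rewrite /spare_code eqxx. Qed.

Section keys.
Variables (V : finType) (M : nat).
Implicit Type A : {set (V + 'I_M)}.

Definition base_part A : {set V} := [set v | inl v \in A]%SET.
Definition spare_part A : {set 'I_M} := [set c | inr c \in A]%SET.
(** A potential edge on base and spare vertices is addressed by its base part [B] and by the
    number [i] of its spare part; it is bit [i] of the colour of [B]. *)
Definition key A : {set V} * nat := (base_part A, spare_code (spare_part A)).
Definition join (B : {set V}) (C : {set 'I_M}) : {set (V + 'I_M)} :=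
  [set s | match s with inl v => v \in B | inr c => c \in C end]%SET.

Lemma base_part_join B C : base_part (join B C) = B.
Proof. by apply/setP => v; rewrite !inE. Qed.

Lemma spare_part_join B C : spare_part (join B C) = C.
Proof. by apply/setP => v; rewrite !inE. Qed.

Lemma key_join B C : key (join B C) = (B, spare_code C).
Proof. by rewrite /key base_part_join spare_part_join. Qed.

Lemma key_inj : injective key.
Proof.
move=> A A' [] /setP hv /spare_code_inj/setP hn; apply/setP => -[v|c].
  by have := hv v; rewrite !inE.
by have := hn c; rewrite !inE.
Qed.

(** What is known when bit [i] of the colour of [B] is sampled: the whole colours of the
    proper subsets of [B] and the bits of [B] before [i]. *)
Definition past (B : {set V}) (i : nat) (K : {set V} * nat) : bool :=
  (K.1 \proper B) || ((K.1 == B) && (K.2 < i)%N).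

(** Everything that may already have been sampled when bit [i] of [B] is: beyond the past,
    the colours of all the sets that do not contain [B]. *)
Definition side (B : {set V}) (i : nat) (K : {set V} * nat) : bool :=
  ~~ (B \subset K.1) || ((K.1 == B) && (K.2 < i)%N).

Lemma past_side B i K : past B i K -> side B i K.
Proof.
rewrite /past /side => /orP[|->]; last by rewrite orbT.
by rewrite fintype.properE => /andP[_ ->].
Qed.

Definition keyset (P : pred ({set V} * nat)) : {set {set (V + 'I_M)}} :=
  [set A | P (key A)]%SET.

Definition hit (B : {set V}) (i : nat) (S : {set {set (V + 'I_M)}}) : bool :=
  [exists A in S, key A == (B, i)].

Definition pat (w : {set V} -> nat -> bool) : {set {set (V + 'I_M)}} :=
  [set A | w (key A).1 (key A).2]%SET.

Lemma hitE B i S A : key A = (B, i) -> hit B i S = (A \in S).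
Proof.
move=> kA; apply/exists_inP/idP => [[A' A'S /eqP]|AS].
  by rewrite -kA => /key_inj <-.
by exists A => //; rewrite kA.
Qed.

End keys.

Arguments keyset {V M}.
Arguments pat {V}.

(** Not every number need be the code of a set, and a code needs enough spare vertices to
    occur; a bit that is not realized is constantly absent. *)
Definition realized (M i : nat) : bool := [exists C : {set 'I_M}, spare_code C == i].

Definition sum_map (V V' : finType) (M M' : nat) (e : V -> V')
    (h : 'I_M -> 'I_M') (s : V + 'I_M) : V' + 'I_M' :=
  match s with inl v => inl (e v) | inr c => inr (h c) end.

Section relabelling.
Variables (V V' : finType) (M M' : nat) (e : V -> V') (h : 'I_M -> 'I_M').
Hypothesis e_inj : injective e.
Hypothesis hE : forall c, h c = c :> nat.

Let tau := sum_map e h.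

Lemma sum_map_inj : injective tau.
Proof.
move=> [v|c] [v'|c'] //= []; first by move/e_inj->.
by move/(congr1 val); rewrite /= !hE => /val_inj ->.
Qed.

Lemma base_part_sum_map (A : {set (V + 'I_M)}) : base_part (tau @: A) = e @: base_part A.
Proof.
apply/setP => v; rewrite inE; apply/imsetP/imsetP.
  by move=> [[w|//] wA [->]]; exists w; rewrite ?inE.
by move=> [w]; rewrite inE => wA ->; exists (inl w).
Qed.

Lemma spare_part_sum_map (A : {set (V + 'I_M)}) : spare_part (tau @: A) = h @: spare_part A.
Proof.
apply/setP => v; rewrite inE; apply/imsetP/imsetP.
  by move=> [[//|w] wA [->]]; exists w; rewrite ?inE.
by move=> [w]; rewrite inE => wA ->; exists (inr w).
Qed.

Lemma key_sum_map (A : {set (V + 'I_M)}) : key (tau @: A) = (e @: (key A).1, (key A).2).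
Proof. by rewrite /key base_part_sum_map spare_part_sum_map spare_code_imset. Qed.

Lemma imset_inj_subset (B C : {set V}) : (e @: B \subset e @: C) = (B \subset C).
Proof.
apply/idP/idP => [/fintype.subsetP h1|]; last exact: imsetS.
by apply/fintype.subsetP => x xB; have := h1 _ (imset_f e xB); rewrite mem_imset.
Qed.

Lemma past_imset (B : {set V}) i (K : {set V} * nat) :
  past (e @: B) i (e @: K.1, K.2) = past B i K.
Proof.
rewrite /past /= !fintype.properE !imset_inj_subset.
by rewrite (inj_eq (imset_inj e_inj)).
Qed.

Lemma pullback_keyset (P' : pred ({set V'} * nat)) (P : pred ({set V} * nat)) S :
  (forall K : {set V} * nat, P' (e @: K.1, K.2) = P K) ->
  pullback tau (S :&: keyset P')%SET = (pullback tau S :&: keyset P)%SET.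
Proof. by move=> PP; apply/setP => A; rewrite !inE key_sum_map PP. Qed.

Lemma pullback_pat w :
  pullback tau (pat M' w) = pat M (fun B i => w (e @: B) i).
Proof. by apply/setP => A; rewrite !inE key_sum_map. Qed.

(** When bit [i] is realized with [M'] spare vertices it must be so with [M]: otherwise
    the left-hand side is constantly false and the right-hand side need not be. *)
Lemma hit_pullback (B : {set V}) i S : (realized M' i -> realized M i) ->
  hit B i (pullback tau S) = hit (e @: B) i S.
Proof.
move=> hr; have [/existsP[C /eqP Ci]|/negP hn] := boolP (realized M' i).
  have /existsP[D /eqP Di] : realized M i.
    by apply: hr; apply/existsP; exists C; rewrite Ci.
  have kD : key (join B D) = (B, i) by rewrite key_join Di.
  rewrite (hitE _ kD) (@hitE _ _ _ _ _ (tau @: join B D)) ?inE//.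
  by rewrite key_sum_map kD.
transitivity false; last first.
  apply/esym/negbTE/negP => /exists_inP[A _ /eqP kA]; apply: hn.
  by apply/existsP; exists (spare_part A); have [_ ->] := kA.
apply/negbTE/negP => /exists_inP[A _ /eqP kA]; apply: hn.
apply/existsP; exists (h @: spare_part A); have [_ <-] := kA.
by rewrite spare_code_imset.
Qed.

End relabelling.

(** * Predicting a bit from the past; conditional independence *)

Section conditioning_on_the_past.
Variables (R : realType) (L : exchangeable_law R).

(** The conditional probability of bit [i] of [B] given the part of its past that is visible
    with [M] spare vertices. *)
Definition pcond (V : finType) (M : nat) (B : {set V}) (i : nat)
    (P : {set {set (V + 'I_M)}}) : R :=
  cond (@law R L _) (fun S => (hit B i S)%:R)
    (fun S => (S :&: keyset (past B i))%SET) P.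

(** The mean squared error of the best prediction of the bit from that past. It decreases
    with the number of spare vertices, and how far it is from its limit controls
    every later estimate. *)
Definition err (V : finType) (M : nat) (B : {set V}) (i : nat) : R :=
  mean L (fun S : {set {set (V + 'I_M)}} =>
    ((hit B i S)%:R - pcond B i (S :&: keyset (past B i))%SET) ^+ 2).

Lemma pcond_itv (V : finType) (M : nat) (B : {set V}) (i : nat)
    (P : {set {set (V + 'I_M)}}) : 0 <= pcond B i P <= 1.
Proof.
by apply: cond_itv => [S|S]; [exact: law_ge0|case: (hit _ _ _); rewrite ?lexx ?ler01].
Qed.

Lemma err_ge0 (V : finType) (M : nat) (B : {set V}) (i : nat) : 0 <= err M B i.
Proof.
by rewrite -(mean_cst L (V + 'I_M)%type 0); apply: le_mean => S; exact: sqr_ge0.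
Qed.

Lemma err_min (V : finType) (M : nat) (B : {set V}) (i : nat) g :
  err M B i <= mean L (fun S : {set {set (V + 'I_M)}} =>
    ((hit B i S)%:R - g (S :&: keyset (past B i))%SET) ^+ 2).
Proof. by apply: cond_min => S; exact: law_ge0. Qed.

Section widening.
Variables (V : finType) (M M' : nat).
Hypothesis leMM' : (M <= M')%N.

Definition widen : V + 'I_M -> V + 'I_M' := sum_map id (widen_ord leMM').

Lemma widen_inj : injective widen.
Proof. exact: sum_map_inj. Qed.

Lemma pullback_widen_keyset P S :
  pullback widen (S :&: keyset P)%SET = (pullback widen S :&: keyset P)%SET.
Proof. by apply: pullback_keyset => // -[B i]; rewrite /= imset_id. Qed.

Lemma pullback_widen_pat w : pullback widen (pat M' w) = pat M w.
Proof.
rewrite pullback_pat//; congr pat; apply/funext => B; apply/funext => i.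
by rewrite imset_id.
Qed.

Lemma hit_widen B i S : realized M i -> hit B i (pullback widen S) = hit B i S.
Proof. by move=> r; rewrite hit_pullback// imset_id. Qed.

Lemma realized_widen i : realized M i -> realized M' i.
Proof.
move=> /existsP[C /eqP <-]; apply/existsP.
by exists (widen_ord leMM' @: C); rewrite spare_code_imset.
Qed.

(** Pythagoras for the two nested conditionings, with [M] and with [M'] spare vertices. *)
Lemma mean_sqr_pcondB (B : {set V}) i : realized M i ->
  mean L (fun S => (pcond B i (S :&: keyset (past B i))%SET -
     pcond B i (pullback widen S :&: keyset (past B i))%SET) ^+ 2)
  = err M B i - err M' B i.
Proof.
move=> r; rewrite {1}/err (mean_pullback L _ widen_inj).
under [X in _ = mean L X - _]eq_fun do rewrite hit_widen// -pullback_widen_keyset.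
under [X in mean L X = _]eq_fun do rewrite -pullback_widen_keyset.
exact: (cond_pythagoras _ _ (@law_ge0 _ L _)
  (fun P => pcond B i (pullback widen P))).
Qed.

Lemma err_widen (B : {set V}) i : realized M i -> err M' B i <= err M B i.
Proof.
move=> r; rewrite -subr_ge0 -mean_sqr_pcondB// -(mean_cst L (V + 'I_M')%type 0).
by apply: le_mean => S; exact: sqr_ge0.
Qed.

End widening.

Section natural.
Variables (V V' : finType) (M : nat) (e : V -> V').
Hypothesis e_inj : injective e.
Let tau := @sum_map V V' M M e id.

(** The past of [e @: B] only involves vertices in the image of [e], so conditioning on it
    takes place before the relabelling. *)
Lemma pcond_natural (B : {set V}) i (P : {set {set (V' + 'I_M)}}) :
  P \subset keyset (past (e @: B) i) ->
  pcond (e @: B) i P = pcond B i (pullback tau P).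
Proof.
move=> Pp; have tau_inj : injective tau by exact: sum_map_inj.
have PE T : (T :&: keyset (past (e @: B) i))%SET == P =
    ((pullback tau T :&: keyset (past B i))%SET == pullback tau P).
  rewrite -(@pullback_keyset _ _ _ _ e id (fun=> erefl) (past (e @: B) i)); last first.
    by move=> K; exact: past_imset.
  apply/eqP/eqP => [<-//|/setP h]; apply/setP => A.
  have [kA|kA] := boolP (past (e @: B) i (key A)); last first.
    rewrite !inE (negbTE kA) andbF; apply/esym/negP => AP.
    by have /fintype.subsetP/(_ A AP) := Pp; rewrite inE (negbTE kA).
  have AB : base_part A \subset e @: B.
    by move: kA => /orP[/proper_sub//|/andP[/eqP/= -> _]].
  suff -> : A = tau @: (tau @^-1: A)%SET by have := h (tau @^-1: A)%SET; rewrite !inE.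
  apply/setP => s; apply/idP/imsetP => [|[t + ->]]; last by rewrite inE.
  case: s => [v|c] sA; last by exists (inr c); rewrite ?inE.
  have /imsetP[w _ vw] : v \in e @: B by move/fintype.subsetP : AB; apply; rewrite inE.
  by exists (inl w); rewrite ?inE/= -?vw.
rewrite /pcond /cond; congr (_ / _).
  transitivity (mean L (fun T => ((T :&: keyset (past (e @: B) i))%SET == P)%:R *
       (hit (e @: B) i T)%:R)).
    rewrite /mean big_mkcond; apply: eq_bigr => T _.
    by case: ifP => _; rewrite ?mul1r// mul0r mulr0.
  under eq_fun do rewrite PE -(@hit_pullback _ _ _ _ _ _ (fun=> erefl))//.
  rewrite -(mean_pullback L (fun T => ((T :&: keyset (past B i))%SET ==
    pullback tau P)%:R * (hit B i T)%:R))//.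
  rewrite /mean [RHS]big_mkcond; apply: eq_bigr => T _.
  by case: ifP => _; rewrite ?mul1r// mul0r mulr0.
transitivity (mean L (fun T => ((T :&: keyset (past (e @: B) i))%SET == P)%:R)).
  rewrite /mean big_mkcond; apply: eq_bigr => T _.
  by case: ifP => _; rewrite ?mulr1// mulr0.
under eq_fun do rewrite PE.
rewrite -(mean_pullback L (fun T => ((T :&: keyset (past B i))%SET ==
    pullback tau P)%:R))//.
rewrite /mean [RHS]big_mkcond; apply: eq_bigr => T _.
by case: ifP => _; rewrite ?mulr1// mulr0.
Qed.

Lemma pcond_pat_natural (B : {set V}) i w :
  pcond (e @: B) i (pat M w :&: keyset (past (e @: B) i))%SET =
  pcond B i (pat M (fun B j => w (e @: B) j) :&: keyset (past B i))%SET.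
Proof.
rewrite pcond_natural ?finset.subsetIr// (pullback_keyset _ (P := past B i))//.
  by rewrite pullback_pat.
by move=> K; exact: past_imset.
Qed.

Lemma err_natural (B : {set V}) i : err M (e @: B) i = err M B i.
Proof.
have tau_inj : injective tau by exact: sum_map_inj.
rewrite /err [RHS](mean_pullback L _ tau_inj); congr mean; apply/funext => S.
rewrite pcond_natural ?finset.subsetIr// (pullback_keyset _ (P := past B i))//.
  by rewrite hit_pullback.
by move=> K; exact: past_imset.
Qed.

End natural.

Section conditional_independence.
Variables (V : finType) (M : nat) (B : {set V}) (i : nat).
Hypothesis ri : realized M i.
Let M' := (M + #|V|)%N.

Let tau (s : V + 'I_M) : V + 'I_M' :=
  match s with
  | inl v => if v \in B then inl v else inr (rshift M (enum_rank v))
  | inr c => inr (lshift #|V| c)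
  end.

Let tau_inj : injective tau.
Proof.
move=> [v|c] [v'|c'] /=.
- case: ifP => _; case: ifP => _ // [].
    by move=> ->.
  by move=> /addnI /ord_inj /enum_rank_inj ->.
- case: ifP => _ // [] h.
  by have := ltn_ord c'; rewrite -h ltnNge leq_addr.
- case: ifP => _ // [] h.
  by have := ltn_ord c; rewrite h ltnNge leq_addr.
- by move=> [] /ord_inj ->.
Qed.

Let base_part_tau (A : {set (V + 'I_M)}) : base_part (tau @: A) = (base_part A :&: B)%SET.
Proof.
apply/setP => v; rewrite !inE; apply/imsetP/andP.
  by move=> [[w|c] wA //=]; case: ifP => // wB [->]; split; [exact: wA|].
by move=> [vA vB]; exists (inl v) => //=; rewrite vB.
Qed.

Let spare_part_tau (A : {set (V + 'I_M)}) : base_part A \subset B ->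
  spare_part (tau @: A) = lshift #|V| @: spare_part A.
Proof.
move=> AB; apply/setP => c; rewrite !inE; apply/imsetP/imsetP.
  move=> [[w|d] wA /=].
    have -> : w \in B by move/fintype.subsetP: AB; apply; rewrite inE.
    by [].
  by move=> [->]; exists d; rewrite ?inE.
by move=> [d]; rewrite inE => dA ->; exists (inr d).
Qed.

Let past_tau (A : {set (V + 'I_M)}) : side B i (key A) -> past B i (key (tau @: A)).
Proof.
rewrite /side /past /= base_part_tau => /orP[nB|/andP[/eqP AB ci]].
  by rewrite fintype.properE finset.subsetIr /= finset.subsetI negb_and nB.
apply/orP; right; rewrite AB finset.setIid eqxx /=.
by rewrite spare_part_tau ?AB// spare_code_imset.
Qed.

(** Any information from the side is worth nothing beyond the past. Let [a] be the
    correlation of the residual with [g]. Predicting with the past plus [a * g] lowers the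
    squared error by [a ^+ 2] at least. But this predictor can be transported by the injection
    [tau], which fixes [B] and the spare vertices and sends the other base vertices to
    fresh spare vertices: it becomes a predictor that only uses the past, visible with
    [M'] spare vertices, so its error is at least [err M' B i]. *)
Lemma conditional_independence (g : {set {set (V + 'I_M)}} -> R) :
  (forall S, `|g S| <= 1) ->
  (mean L (fun S => ((hit B i S)%:R - pcond B i (S :&: keyset (past B i))%SET)
      * g (S :&: keyset (side B i))%SET)) ^+ 2
  <= err M B i - err M' B i.
Proof.
move=> g1; set a := mean _ _.
(* The coefficient a is the one that minimizes the error when the mean of g^2 is 1. *)
pose f S := pcond B i (S :&: keyset (past B i))%SET +
  a * g (S :&: keyset (side B i))%SET.
have h : err M' B i <= mean L (fun S => ((hit B i S)%:R - f S) ^+ 2).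
  rewrite (mean_pullback L _ tau_inj).
  apply: (le_trans (err_min B i (fun P => f (pullback tau P)))).
  rewrite le_eqVlt; apply/orP; left; apply/eqP; congr mean; apply/funext => S.
  congr ((_ - _) ^+ 2).
    have /existsP[C /eqP Ci] := ri.
    have kC : key (join B C) = (B, i) by rewrite key_join Ci.
    rewrite (hitE _ kC) (@hitE _ _ _ _ _ (tau @: join B C)) ?inE//.
    rewrite /key base_part_tau spare_part_tau base_part_join ?finset.setIid//.
    by rewrite spare_code_imset// spare_part_join Ci.
  have E (P : pred ({set V} * nat)) : (forall K, P K -> side B i K) ->
      (pullback tau (S :&: keyset (past B i)) :&: keyset P)%SET =
      (pullback tau S :&: keyset P)%SET.
    move=> Ps; apply/setP => A; rewrite !inE.
    case: (boolP (P (key A))) => [/Ps/past_tau ->|]; last by rewrite !andbF.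
    by rewrite andbT.
  by rewrite /f !E// => K; exact: past_side.
rewrite lerBrDl -lerBrDr; apply: (le_trans h).
pose gs S := g (S :&: keyset (side B i))%SET.
have -> : mean L (fun S => ((hit B i S)%:R - f S) ^+ 2) =
    err M B i - 2 * a * mean L (fun S => ((hit B i S)%:R -
       pcond B i (S :&: keyset (past B i))%SET) * gs S) +
    a ^+ 2 * mean L (fun S => gs S ^+ 2).
  rewrite /err -(meanZ _ (2 * a)) -(meanZ _ (a ^+ 2)) -meanB -meanD.
  by congr mean; apply/funext => S; rewrite /f /gs; ring.
rewrite -/a; have : mean L (fun S => gs S ^+ 2) <= 1.
  rewrite -(mean_cst L (V + 'I_M)%type 1); apply: le_mean => S.
  by rewrite -real_normK ?num_real// expr_le1// /gs g1.
move: (sqr_ge0 a) => a2 m1; have := ler_wpM2l a2 m1; lra.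
Qed.

End conditional_independence.

End conditioning_on_the_past.

(** * Expectations of bounded measurable functions *)

Section bounded_expectation.
Context {R : realType} {d : measure_display} {T : measurableType d}.

(** All the integrands are real-valued, bounded and measurable, which makes expectation
    linear without integrability conditions. *)
Definition bmeas (f : T -> R) : Prop :=
  measurable_fun [set: T] f /\ exists c, forall x, `|f x| <= c.

Definition Ex (P : probability T R) (f : T -> R) : R := \int[P]_x f x.

Lemma bmeas_cst (c : R) : bmeas (fun=> c).
Proof. by split; [exact: measurable_cst|exists `|c|]. Qed.

Lemma bmeasD f g : bmeas f -> bmeas g -> bmeas (fun x => f x + g x).
Proof.
move=> [mf [a fa]] [mg [b gb]]; split; first exact: measurable_funD.
by exists (a + b) => x; apply: le_trans (ler_normD _ _) _; exact: lerD.
Qed.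

Lemma bmeasM f g : bmeas f -> bmeas g -> bmeas (fun x => f x * g x).
Proof.
move=> [mf [a fa]] [mg [b gb]]; split; first exact: measurable_funM.
by exists (a * b) => x; rewrite normrM ler_pM.
Qed.

Lemma bmeasZ c f : bmeas f -> bmeas (fun x => c * f x).
Proof. by move=> bf; apply: bmeasM => //; exact: bmeas_cst. Qed.

Lemma bmeasB f g : bmeas f -> bmeas g -> bmeas (fun x => f x - g x).
Proof.
move=> bf bg; under eq_fun do rewrite -mulN1r.
by apply: bmeasD => //; exact: bmeasZ.
Qed.

Lemma bmeas_norm f : bmeas f -> bmeas (fun x => `|f x|).
Proof.
move=> [mf [a fa]]; split; first exact: measurableT_comp.
by exists a => x; rewrite normr_id.
Qed.

Lemma bmeas_prod (I : eqType) (s : seq I) (f : I -> T -> R) :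
  (forall i, i \in s -> bmeas (f i)) -> bmeas (fun x => \prod_(i <- s) f i x).
Proof.
elim: s => [_|i s IH h].
  by under eq_fun do rewrite big_nil; exact: bmeas_cst.
under eq_fun do rewrite big_cons.
apply: bmeasM; first by apply: h; rewrite mem_head.
by apply: IH => j js; apply: h; rewrite in_cons js orbT.
Qed.

Lemma bmeas_bool (b : T -> bool) :
  measurable_fun [set: T] b -> bmeas (fun x => (b x)%:R).
Proof.
move=> mb; split; last by exists 1 => x; case: (b x); rewrite ?normr1 ?normr0.
rewrite (_ : (fun _ => _) = fun x => if b x then 1 else 0).
  by apply: measurable_fun_ifT => //; exact: measurable_cst.
by apply/funext => x; case: (b x).
Qed.

Lemma bmeas01 (f : T -> R) : measurable_fun [set: T] f ->
  (forall x, 0 <= f x <= 1) -> bmeas f.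
Proof.
move=> mf f01; split=> //; exists 1 => x.
by have /andP[? ?] := f01 x; rewrite ger0_norm.
Qed.

Lemma bmeas_integrable (P : probability T R) f :
  bmeas f -> P.-integrable [set: T] (EFin \o f).
Proof.
move=> [mf [c fc]]; apply: measurable_bounded_integrable => //.
  by rewrite -ge0_fin_numE ?fin_num_measure.
exists c; split; first by rewrite num_real.
by move=> x cx y _; apply: le_trans (fc y) (ltW cx).
Qed.

Variable P : probability T R.

Lemma Ex_cst c : Ex P (fun=> c) = c.
Proof.
have PT : (P : {measure set T -> \bar R}) [set: T] = 1%E := probability_setT P.
by rewrite /Ex Rintegral_cst// PT mulr1.
Qed.

Lemma ExD f g : bmeas f -> bmeas g -> Ex P (fun x => f x + g x) = Ex P f + Ex P g.
Proof. by move=> bf bg; apply: RintegralD => //; exact: bmeas_integrable. Qed.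

Lemma ExZ c f : bmeas f -> Ex P (fun x => c * f x) = c * Ex P f.
Proof. by move=> bf; apply: RintegralZl => //; exact: bmeas_integrable. Qed.

Lemma ExB f g : bmeas f -> bmeas g -> Ex P (fun x => f x - g x) = Ex P f - Ex P g.
Proof. by move=> bf bg; apply: RintegralB => //; exact: bmeas_integrable. Qed.

Lemma le_Ex f g : bmeas f -> bmeas g -> (forall x, f x <= g x) -> Ex P f <= Ex P g.
Proof. by move=> bf bg fg; apply: le_Rintegral => //; exact: bmeas_integrable. Qed.

Lemma EFin_Ex f : bmeas f -> (\int[P]_x (f x)%:E = (Ex P f)%:E)%E.
Proof.
by move=> bf; rewrite /Ex /Rintegral fineK// integrable_fin_num// bmeas_integrable.
Qed.

Lemma Ex_bool (A : set T) : measurable A ->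
  Ex P (fun x => (x \in A)%:R) = fine (P A).
Proof.
move=> mA; rewrite /Ex /Rintegral; congr fine.
by rewrite -[X in P X](setIT A) -(@integral_indic _ _ _ P).
Qed.


(** An event of probability one may be inserted in any expectation. *)
Lemma Ex_full (A : set T) (f : T -> R) : measurable A -> P A = 1%E -> bmeas f ->
  Ex P (fun x => (x \in A)%:R * f x) = Ex P f.
Proof.
move=> mA PA bf; have [_ [c fc]] := bf.
have bA : bmeas (fun x => (x \in A)%:R : R).
  by apply: bmeas_bool; apply: (@measurable_fun_bool _ _ _ _ true) => //;
    rewrite setTI (_ : _ @^-1` _ = A)//; apply/seteqP; split=> x;
    [exact: set_mem|exact: mem_set].
pose J x : R := 1 - (x \in A)%:R.
have bJ : bmeas J by apply: bmeasB => //; exact: bmeas_cst.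
have J0 x : 0 <= J x by rewrite /J; case: (x \in A); rewrite ?subrr// subr0.
have EJ : Ex P J = 0 by rewrite ExB ?Ex_cst ?Ex_bool// ?PA ?subrr//; exact: bmeas_cst.
apply/eqP; rewrite eq_sym -subr_eq0 -ExB//; last exact: bmeasM.
rewrite (_ : (fun x => _) = fun x => J x * f x); last first.
  by apply/funext => x; rewrite /J mulrBl mul1r.
have bJf : bmeas (fun x => J x * f x) by exact: bmeasM.
rewrite eq_le; apply/andP; split.
  apply: (@le_trans _ _ (Ex P (fun x => c * J x))); last by rewrite ExZ// EJ mulr0.
  apply: le_Ex => // [|x]; first exact: bmeasZ.
  by rewrite mulrC ler_wpM2r//; have := fc x; rewrite ler_norml => /andP[].
apply: (@le_trans _ _ (Ex P (fun x => - c * J x))); first by rewrite ExZ// EJ mulr0.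
apply: le_Ex => // [|x]; first exact: bmeasZ.
by rewrite [leRHS]mulrC ler_wpM2r//; have := fc x; rewrite ler_norml => /andP[].
Qed.

Lemma Ex_dominated (f : nat -> T -> R) (g : T -> R) (c : R) :
  (forall n, measurable_fun [set: T] (f n)) -> measurable_fun [set: T] g ->
  (forall n x, `|f n x| <= c) ->
  {ae P, forall x, (f ^~ x) @ \oo --> g x} ->
  (fun n => Ex P (f n)) @ \oo --> Ex P g.
Proof.
move=> mf mg fc fg.
have bf n : bmeas (f n) by split=> //; exists c.
have [ig _ h] := @dominated_convergence _ _ _ P setT measurableT
  (fun n x => (f n x)%:E) (EFin \o g) (fun=> c%:E)
  ltac:(by move=> n; apply/measurable_EFinP)
  ltac:(by apply/measurable_EFinP)
  ltac:(by apply: filterS fg => x fgx _; apply: cvg_EFin => //; exact: nearW)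
  (finite_measure_integrable_cst _ _ measurableT)
  ltac:(by apply: aeW => x n _; rewrite lee_fin).
have eg : (\int[P]_x (g x)%:E = (Ex P g)%:E)%E.
  by rewrite /Ex /Rintegral fineK// integrable_fin_num.
by move: h; rewrite /= eg => /fine_cvg.
Qed.

End bounded_expectation.

Section change_of_variables.
Context {R : realType} {d d' : measure_display}.
Context {T : measurableType d} {T' : measurableType d'}.

Lemma bmeas_comp (f : T' -> R) (phi : T -> T') :
  measurable_fun [set: T] phi -> bmeas f -> bmeas (fun x => f (phi x)).
Proof.
by move=> mphi [mf [c fc]]; split; [exact: measurableT_comp|exists c].
Qed.

Lemma Ex_image (P : probability T R) (Q : probability T' R) (phi : T -> T')
    (f : T' -> R) : measurable_fun [set: T] phi ->
  (forall A, measurable A -> Q A = P (phi @^-1` A)) ->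
  bmeas f -> Ex Q f = Ex P (fun x => f (phi x)).
Proof.
move=> mphi QP bf; rewrite /Ex /Rintegral; congr fine.
pose X : {mfun T >-> T'} := mfun_Sub (mem_set mphi).
transitivity (\int[distribution P X]_x (f x)%:E)%E.
  by apply: eq_measure_integral => A mA _; exact: QP.
rewrite integral_distribution//; first by apply/measurable_EFinP; have [] := bf.
exact: (bmeas_integrable P (bmeas_comp mphi bf)).
Qed.

End change_of_variables.

Section fubini.
Context {R : realType} {d d' : measure_display}.
Context {T : measurableType d} {T' : measurableType d'}.
Variables (P : probability T R) (Q : probability T' R).

Lemma Ex_Fubini (f : T * T' -> R) : bmeas f ->
  Ex (P \x Q)%E f = Ex P (fun x => Ex Q (fun y => f (x, y))).
Proof.
move=> bf; rewrite [LHS]/Ex /Rintegral -integral12_prod_meas1; last first.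
  exact: (bmeas_integrable _ bf).
rewrite [RHS]/Ex /Rintegral; congr fine; apply: eq_integral => x _.
rewrite /fubini_F EFin_Ex//; apply: (bmeas_comp _ bf).
exact: pair1_measurable.
Qed.

Lemma bmeas_section (f : T * T' -> R) x : bmeas f -> bmeas (fun y => f (x, y)).
Proof. by apply: bmeas_comp; exact: pair1_measurable. Qed.

Lemma bmeas_Ex (f : T * T' -> R) : bmeas f ->
  bmeas (fun x => Ex Q (fun y => f (x, y))).
Proof.
move=> bf; split.
  apply/measurable_EFinP.
  rewrite (_ : EFin \o _ = fubini_F Q (EFin \o f)).
    exact: (measurable_fubini_F (bmeas_integrable (P \x Q)%E bf)).
  apply/funext => x /=; rewrite /fubini_F/= EFin_Ex//; exact: bmeas_section.
have [mf [c fc]] := bf; exists c => x.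
have bx := bmeas_section x bf.
rewrite ler_norml; apply/andP; split.
  rewrite -(Ex_cst Q (- c)); apply: le_Ex => //; first exact: bmeas_cst.
  by move=> y; have := fc (x, y); rewrite ler_norml => /andP[].
rewrite -(Ex_cst Q c); apply: le_Ex => //; first exact: bmeas_cst.
by move=> y; have := fc (x, y); rewrite ler_norml => /andP[].
Qed.

End fubini.

(** * Products of uniform measures *)

Section cubes.
Variable R : realType.

Definition U01 : probability (measurableTypeR R) R := uniform_prob (@ltr01 R).

Lemma measurable_point {d} {T : measurableType d} (I : finType)
    (phi : T -> point R I) :
  (forall i, measurable_fun [set: T] (fun z => phi z i : measurableTypeR R)) ->
  measurable_fun [set: T] phi.
Proof.
move=> mphi; apply: (@measurability _ _ _ _ _ _
  (\bigcup_i preimage_set_system setT (fun x : point R I => x i) measurable)) => //.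
move=> _ [_ [i _ [A mA <-]] <-].
rewrite !setTI [X in measurable X](_ : _ = (fun z => phi z i) @^-1` A)//.
by rewrite -[X in measurable X]setTI; exact: mphi.
Qed.

Lemma measurable_coord (I : finType) (i : I) :
  measurable_fun [set: point R I] (fun x => x i : measurableTypeR R).
Proof.
move=> _ A mA; apply: sub_sigma_algebra; exists i => //.
by exists A.
Qed.

Definition box (I : finType) (A : I -> set (measurableTypeR R)) : set (point R I) :=
  [set x | forall i, A i (x i)].

Lemma measurable_box (I : finType) (A : I -> set (measurableTypeR R)) :
  (forall i, measurable (A i)) -> measurable (box A).
Proof.
move=> mA; rewrite (_ : box A =
    \bigcap_(i in [set: I]) ((fun x : point R I => x i) @^-1` A i)).
  apply: fin_bigcap_measurable => // i _.
  by rewrite -[X in measurable X]setTI; exact: measurable_coord.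
by apply/seteqP; split=> x /= h i; [move=> _|]; apply: h.
Qed.

(** Boxes form a generating pi-system. *)
Lemma cube_uniform_unique (I : finType) (mu : {measure set (point R I) -> \bar R}) :
  (forall A : I -> set (measurableTypeR R), (forall i, measurable (A i)) ->
    mu (box A) = (\prod_i U01 (A i))%E) ->
  forall E, measurable E -> cube_uniform R I E = mu E.
Proof.
move=> muE E mE.
pose G := [set E : set (point R I) |
  exists2 A, (forall i, measurable (A i)) & E = box A].
have boxT : box (fun=> setT) = [set: point R I] by apply/seteqP; split.
have GT : G setT by exists (fun=> setT).
apply: (@measure_unique _ _ _ G (fun=> setT)) => //.
- apply/seteqP; split; last first.
    apply: smallest_sub; first exact: sigma_algebra_measurable.
    by move=> _ [A mA ->]; exact: measurable_box.
  apply: smallest_sub; first exact: smallest_sigma_algebra.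
  move=> _ [i _ [A mA <-]]; apply: sub_sigma_algebra.
  exists (fun j => if j == i then A else setT).
    by move=> j; case: ifP.
  apply/seteqP; split=> x /=.
    by move=> [_ Ax] j; case: eqP => // ->.
  by move=> /(_ i); rewrite eqxx.
- move=> _ _ [A mA ->] [B mB ->]; exists (fun i => A i `&` B i).
    by move=> i; exact: measurableI.
  apply/seteqP; split=> x /=; first by move=> [h1 h2] i; split.
  by move=> h; split=> i; have [] := h i.
- by apply/seteqP; split=> // x _; exists 0%N.
- move=> _ [A mA ->]; rewrite muE//; exact: cube_uniform_box.
- by move=> _; rewrite -ge0_fin_numE ?fin_num_measure.
Qed.

Lemma Ex_cube_image {d} {T : measurableType d} (P : probability T R) (I : finType)
    (phi : T -> point R I) (f : point R I -> R) :
  measurable_fun [set: T] phi ->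
  (forall A : I -> set (measurableTypeR R), (forall i, measurable (A i)) ->
    P (phi @^-1` box A) = (\prod_i U01 (A i))%E) ->
  bmeas f -> Ex (cube_uniform R I) f = Ex P (fun x => f (phi x)).
Proof.
move=> mphi PE; apply: Ex_image => // E mE.
pose X : {mfun T >-> point R I} := mfun_Sub (mem_set mphi).
exact: (@cube_uniform_unique I (distribution P X)).
Qed.

Definition reindex_point (I J : finType) (th : I -> J) (x : point R J) : point R I :=
  [ffun i => x (th i)].

Definition upd (I : finType) (x : point R I) (i : I) (t : measurableTypeR R) :
  point R I := [ffun j => if j == i then t else x j].

Lemma measurable_reindex_point (I J : finType) (th : I -> J) :
  measurable_fun setT (reindex_point th).
Proof.
apply: measurable_point => i.
under eq_fun do rewrite ffunE; exact: measurable_coord.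
Qed.

(** Projecting the cube to some of its coordinates, or permuting them, gives a uniform
    point again. *)
Lemma Ex_reindex (I J : finType) (th : I -> J) (f : point R I -> R) :
  injective th -> bmeas f ->
  Ex (cube_uniform R I) f = Ex (cube_uniform R J) (fun x => f (reindex_point th x)).
Proof.
move=> th_inj; apply: Ex_cube_image; first exact: measurable_reindex_point.
move=> A mA.
pose A' j := if [pick i | th i == j] is Some i then A i else setT.
have A'E i : A' (th i) = A i.
  rewrite /A'; case: pickP => [i' /eqP/th_inj -> //|/(_ i)]; by rewrite eqxx.
rewrite [X in _ X = _](_ : _ = box A'); last first.
  apply/seteqP; split=> x /= h i.
    by rewrite /A'; case: pickP => // i' /eqP <-; have := h i'; rewrite ffunE.
  by rewrite ffunE -A'E.
rewrite [LHS]cube_uniform_box; last by move=> j; rewrite /A'; case: pickP.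
rewrite (bigID (mem (codom th))) /= [X in (_ * X)%E]big1 ?mule1; last first.
  move=> j jN; rewrite /A'; case: pickP => [i /eqP ij|_]; last exact: probability_setT.
  by rewrite -ij codom_f in jN.
rewrite -big_filter (perm_big (codom th)) /=; last first.
  apply: uniq_perm; rewrite ?filter_uniq ?index_enum_uniq//.
    by rewrite map_inj_uniq// enum_uniq.
  by move=> j; rewrite mem_filter mem_index_enum andbT.
by rewrite big_map big_enum /=; apply: eq_bigr => i _; rewrite A'E.
Qed.

Lemma measurable_upd (I : finType) (i : I) :
  measurable_fun setT (fun z : point R I * measurableTypeR R => upd z.1 i z.2).
Proof.
apply: measurable_point => j; under eq_fun do rewrite ffunE.
case: eqP => _; first exact: measurable_snd.
exact: (measurableT_comp (measurable_coord _) measurable_fst).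
Qed.

(** Replacing one coordinate by a fresh uniform variable does not change the law; this is
    how a single coordinate is integrated out. *)
Lemma Ex_resample (I : finType) (i : I) (f : point R I -> R) : bmeas f ->
  Ex (cube_uniform R I) f =
  Ex (cube_uniform R I) (fun x => Ex U01 (fun t => f (upd x i t))).
Proof.
move=> bf.
rewrite -(@Ex_Fubini _ _ _ _ _ _ _ (fun z => f (upd z.1 i z.2))); last first.
  by apply: (bmeas_comp _ bf); exact: measurable_upd.
apply: (Ex_cube_image (phi := fun z => upd z.1 i z.2)) => //.
  exact: measurable_upd.
move=> A mA; rewrite [X in _ X = _](_ : _ =
    box (fun j => if j == i then setT else A j) `*` A i); last first.
  apply/seteqP; split=> -[x t] /=.
    move=> h; split; last by have := h i; rewrite ffunE eqxx.
    by move=> j; case: eqP => // /eqP ji; have := h j; rewrite ffunE (negbTE ji).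
  move=> [h1 h2] j; rewrite ffunE; case: eqP => [->//|/eqP ji].
  by have := h1 j; rewrite (negbTE ji).
rewrite [LHS]product_measure1E//; last first.
  by apply: measurable_box => j; case: ifP.
rewrite [X in (X * _)%E = _]cube_uniform_box; last by move=> j; case: ifP.
rewrite (bigD1 i)//= eqxx [X in (X * _ * _)%E](@probability_setT _ _ _ U01) mul1e.
rewrite [RHS](bigD1 i)//= muleC; congr (_ * _)%E.
by apply: eq_bigr => j /negbTE ->.
Qed.

Lemma Ex_independent (I1 I2 J : finType) (th1 : I1 -> J) (th2 : I2 -> J)
    (f1 : point R I1 -> R) (f2 : point R I2 -> R) :
  injective th1 -> injective th2 -> (forall i1 i2, th1 i1 <> th2 i2) ->
  bmeas f1 -> bmeas f2 ->
  Ex (cube_uniform R J) (fun x => f1 (reindex_point th1 x) * f2 (reindex_point th2 x))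
  = Ex (cube_uniform R I1) f1 * Ex (cube_uniform R I2) f2.
Proof.
move=> inj1 inj2 disj b1 b2.
pose th (s : I1 + I2) := match s with inl i => th1 i | inr i => th2 i end.
pose g (x : point R (I1 + I2)%type) :=
  f1 (reindex_point inl x) * f2 (reindex_point inr x).
have bg : bmeas g.
  by apply: bmeasM; apply: bmeas_comp => //; exact: measurable_reindex_point.
transitivity (Ex (cube_uniform R (I1 + I2)%type) g).
  rewrite (Ex_reindex (th := th))//; last first.
    move=> [a|a] [b|b] //=; first by move/inj1->.
    - by move/disj.
    - by move/esym/disj.
    - by move/inj2->.
  by congr Ex; apply/funext => x; congr (f1 _ * f2 _); apply/ffunP => i; rewrite !ffunE.
pose phi (z : point R I1 * point R I2) : point R (I1 + I2)%type :=
  [ffun s => match s with inl i => z.1 i | inr i => z.2 i end].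
have mphi : measurable_fun setT phi.
  apply: measurable_point => -[i|i]; under eq_fun do rewrite ffunE.
    exact: (measurableT_comp (measurable_coord _) measurable_fst).
  exact: (measurableT_comp (measurable_coord _) measurable_snd).
rewrite (@Ex_cube_image _ _ (cube_uniform R I1 \x cube_uniform R I2)%E _ phi)//.
  rewrite Ex_Fubini; last exact: bmeas_comp.
  transitivity (Ex (cube_uniform R I1) (fun x => Ex (cube_uniform R I2) f2 * f1 x)).
    congr Ex; apply/funext => x; rewrite mulrC -ExZ//.
    congr Ex; apply/funext => y; rewrite /g; congr (f1 _ * f2 _);
      by apply/ffunP => i; rewrite !ffunE.
  by rewrite ExZ// mulrC.
move=> A mA; rewrite [X in _ X = _](_ : _ =
    box (fun i => A (inl i)) `*` box (fun i => A (inr i))); last first.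
  apply/seteqP; split=> -[x y] /=.
    move=> h; split=> i; first by have := h (inl i); rewrite ffunE.
    by have := h (inr i); rewrite ffunE.
  by move=> [h1 h2] [i|i]; rewrite ffunE.
rewrite [LHS]product_measure1E//; [|exact: measurable_box..].
by rewrite big_sumType/=; congr (_ * _)%E; exact: cube_uniform_box.
Qed.

End cubes.

(** * Arithmetic coding of a bit sequence by one uniform variable *)

Definition set_bit (s : nat -> bool) (i : nat) (b : bool) : nat -> bool :=
  fun j => if j == i then b else s j.

Definition bits_before (s : nat -> bool) (i : nat) : nat -> bool :=
  fun j => (j < i)%N && s j.

Section coder.
Variable R : realType.
Implicit Type Q : nat -> (nat -> bool) -> R.

(** The state consists of the bits read so far, the left end and the length of the current
    subinterval of [0, 1[. The next bit splits that interval in proportion [Q : 1 - Q],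
    where [Q] is the prescribed probability of a 1 given the bits before, and records in
    which part [t] lies. *)
Definition coder_bit (t : R) Q (i : nat) (st : (nat -> bool) * R * R) : bool :=
  t < st.1.2 + st.2 * Q i st.1.1.

Definition coder_step (t : R) Q (st : (nat -> bool) * R * R) (i : nat) :
    (nat -> bool) * R * R :=
  if coder_bit t Q i st
  then (set_bit st.1.1 i true, st.1.2, st.2 * Q i st.1.1)
  else (set_bit st.1.1 i false, st.1.2 + st.2 * Q i st.1.1,
        st.2 * (1 - Q i st.1.1)).

Definition coder_state (t : R) Q (n : nat) : (nat -> bool) * R * R :=
  foldl (coder_step t Q) (xpred0, 0, 1) (iota 0 n).

Definition coder (t : R) Q (i : nat) : bool := coder_bit t Q i (coder_state t Q i).

Lemma coder_stateS t Q n :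
  coder_state t Q n.+1 = coder_step t Q (coder_state t Q n) n.
Proof. by rewrite /coder_state -addn1 iotaD foldl_cat add0n. Qed.

Lemma coder_state_bits_before t Q n : (coder_state t Q n).1.1 = bits_before (coder t Q) n.
Proof.
elim: n => [|n IH]; first by apply/funext => j; rewrite /bits_before ltn0.
rewrite coder_stateS; apply/funext => j.
have -> : (coder_step t Q (coder_state t Q n) n).1.1 =
    set_bit (coder_state t Q n).1.1 n (coder t Q n).
  by rewrite /coder_step /coder; case: ifP.
rewrite IH /set_bit /bits_before ltnS (leq_eqVlt j n).
by case: (j =P n) => [->|].
Qed.

Lemma U01_itv (a b : R) : 0 <= a -> a <= b -> b <= 1 ->
  U01 R `[a, b[%classic = (b - a)%:E.
Proof.
move=> a0 ab b1.
transitivity (\int[lebesgue_measure]_(x in `[a, b[) (uniform_pdf 0 1 x)%:E)%E => //.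
rewrite integral_uniform_pdf setIidl; last first.
  move=> x /=; rewrite !in_itv/= => /andP[ax xb].
  by rewrite (le_trans a0)//= (le_trans (ltW xb)).
rewrite (eq_integral (fun=> 1%:E)); last first.
  move=> x; rewrite inE/= in_itv/= => /andP[ax xb]; rewrite /uniform_pdf.
  by rewrite (le_trans a0 ax) (le_trans (ltW xb) b1) subr0 invr1.
rewrite integral_cst//= mul1e lebesgue_measure_itv/= lte_fin.
case: ltP => //; rewrite le_eqVlt ltNge ab orbF => /eqP ->.
by rewrite subrr.
Qed.

Section expectation.
Variables (Q : nat -> (nat -> bool) -> R) (f : bool -> (nat -> bool) -> R) (c : R).
Hypothesis Q01 : forall i s, 0 <= Q i s <= 1.
Hypothesis fc : forall b s, `|f b s| <= c.

(** The expectation of [f] of the next bit and of the bits before it when the bits are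
    sampled one after the other with probabilities [Q]. *)
Fixpoint tree (n i : nat) (s : nat -> bool) : R :=
  match n with
  | 0 => Q i s * f true s + (1 - Q i s) * f false s
  | n'.+1 => Q i s * tree n' i.+1 (set_bit s i true) +
             (1 - Q i s) * tree n' i.+1 (set_bit s i false)
  end.

Let run (n i : nat) (st : (nat -> bool) * R * R) (t : R) : R :=
  let st' := foldl (coder_step t Q) st (iota i n) in
  f (coder_bit t Q (i + n) st') st'.1.1.

Let runS n i st t : run n.+1 i st t =
  if t < st.1.2 + st.2 * Q i st.1.1
  then run n i.+1 (set_bit st.1.1 i true, st.1.2, st.2 * Q i st.1.1) t
  else run n i.+1 (set_bit st.1.1 i false, st.1.2 + st.2 * Q i st.1.1,
        st.2 * (1 - Q i st.1.1)) t.
Proof.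
rewrite /run /= -addSnnS.
by rewrite [coder_step t Q st i]/coder_step [coder_bit t Q i st]/coder_bit; case: ifP.
Qed.

Let bmeas_lt (a : R) : measurable_fun setT (fun t : measurableTypeR R => t < a).
Proof. by apply: measurable_fun_ltr => //; exact: measurable_cst. Qed.

Let bmeas_run n i st : bmeas (run n i st : measurableTypeR R -> R).
Proof.
split; last by exists c => t; exact: fc.
elim: n i st => [|n IH] i [[s l] r].
  rewrite /run/= (_ : (fun t => _) = fun t : measurableTypeR R =>
     if t < l + r * Q i s then f true s else f false s).
    by apply: measurable_fun_ifT => //; exact: measurable_cst.
  by apply/funext => t; rewrite addn0 /coder_bit/=; case: ifP.
rewrite (_ : run n.+1 i (s, l, r) = fun t : measurableTypeR R =>
    if t < l + r * Q i s then run n i.+1 (set_bit s i true, l, r * Q i s) t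
    else run n i.+1 (set_bit s i false, l + r * Q i s, r * (1 - Q i s)) t).
  by apply: measurable_fun_ifT.
by apply/funext => t; rewrite runS.
Qed.

Let ind (a b t : R) : R := (t \in `[a, b[)%:R.

Let bmeas_ind a b : bmeas (ind a b : measurableTypeR R -> R).
Proof.
apply: bmeas_bool; rewrite /ind; under eq_fun do rewrite in_itv/=.
apply: measurable_and => //; apply: measurable_fun_ler => //; exact: measurable_cst.
Qed.

Let Ex_ind (a b : R) : 0 <= a -> a <= b -> b <= 1 -> Ex (U01 R) (ind a b) = b - a.
Proof.
move=> a0 ab b1; rewrite /ind.
rewrite (_ : (fun t => _) = fun t : measurableTypeR R => (t \in `[a, b[%classic)%:R).
  by rewrite Ex_bool// U01_itv.
by apply/funext => t; rewrite mem_setE.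
Qed.

Let ind_split (l m u t : R) : l <= m -> m <= u ->
  ind l u t = ind l m t + ind m u t.
Proof.
move=> lm mu; rewrite /ind !in_itv/=.
have [tm|mt] := ltP t m.
  by rewrite (lt_le_trans tm mu) andbT addr0.
by rewrite (le_trans lm mt) andbF add0r.
Qed.

(** A run started on [[l, l + r[] only sees the part of the uniform variable in that
    interval, and the first step splits it in two such runs. *)
Lemma Ex_run n i s l r : 0 <= l -> 0 <= r -> l + r <= 1 ->
  Ex (U01 R) (fun t => ind l (l + r) t * run n i (s, l, r) t) = r * tree n i s.
Proof.
elim: n i s l r => [|n IH] i s l r l0 r0 lr1; have /andP[q0 q1] := Q01 i s;
  set m := l + r * Q i s;
  have lm : l <= m by rewrite lerDl mulr_ge0.
  have mu : m <= l + r by rewrite lerD2l ler_piMr.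
  rewrite (_ : (fun t => _) =
      fun t => f true s * ind l m t + f false s * ind m (l + r) t).
    rewrite ExD ?ExZ; [|exact: bmeas_ind|exact: bmeas_ind|exact: bmeasZ|exact: bmeasZ].
    rewrite !Ex_ind//; [|lra|lra].
    by rewrite /m /=; ring.
  apply/funext => t; rewrite (ind_split _ lm mu) /run /= addn0 /coder_bit/= -/m.
  rewrite /ind !in_itv/=; case: (ltP t m) => tm; rewrite ?andbF ?andbT /=; ring.
have mu : m <= l + r by rewrite lerD2l ler_piMr.
have mE : m + r * (1 - Q i s) = l + r by rewrite /m; ring.
rewrite (_ : (fun t => _) = fun t =>
    ind l (l + r * Q i s) t * run n i.+1 (set_bit s i true, l, r * Q i s) t +
    ind m (m + r * (1 - Q i s)) t * run n i.+1 (set_bit s i false, m, r * (1 - Q i s)) t).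
  rewrite ExD; [|exact: bmeasM|exact: bmeasM].
  rewrite !IH//= ?mE//.
  - by ring.
  - by lra.
  - by rewrite mulr_ge0//; lra.
  - by rewrite mulr_ge0.
  - by rewrite -/m; lra.
apply/funext => t; rewrite mE runS /= -/m (ind_split _ lm mu).
rewrite /ind !in_itv/=; case: (ltP t m) => tm; rewrite ?andbF ?andbT /=; ring.
Qed.

Lemma Ex_coder_tree i :
  Ex (U01 R) (fun t => f (coder t Q i) (bits_before (coder t Q) i)) = tree i 0 xpred0.
Proof.
have runE t : f (coder t Q i) (bits_before (coder t Q) i) = run i 0 (xpred0, 0, 1) t.
  by rewrite -coder_state_bits_before.
under [X in Ex _ X]eq_fun do rewrite runE.
pose A : set (measurableTypeR R) := `[0, 1[%classic.
have A1 : U01 R A = 1%E by rewrite /A U01_itv// subr0.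
have mA : measurable A by exact: measurable_itv.
rewrite -(Ex_full mA A1 (bmeas_run i 0 (xpred0, 0, 1))).
rewrite -[RHS]mul1r -(@Ex_run i 0 xpred0 0 1)// ?add0r//.
by congr Ex; apply/funext => t; rewrite /ind /A mem_setE.
Qed.

End expectation.

(** Given the bits before it, bit [i] of the code of a uniform variable is 1 with
    probability [Q i]: both sides unfold to the same tree. *)
Lemma Ex_coder (Q : nat -> (nat -> bool) -> R) (psi : (nat -> bool) -> R) (c : R) i :
  (forall j s, 0 <= Q j s <= 1) -> (forall s, `|psi s| <= c) ->
  Ex (U01 R) (fun t => (coder t Q i)%:R * psi (bits_before (coder t Q) i)) =
  Ex (U01 R) (fun t => Q i (bits_before (coder t Q) i) * psi (bits_before (coder t Q) i)).
Proof.
move=> Q01 psic; pose f1 (b : bool) s : R := b%:R * psi s.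
pose f2 (b : bool) s : R := Q i s * psi s.
have f1c b s : `|f1 b s| <= c.
  rewrite /f1; case: b; rewrite ?mul1r// mul0r normr0.
  exact: le_trans (normr_ge0 _) (psic s).
have f2c b s : `|f2 b s| <= c.
  rewrite /f2 normrM; have /andP[q0 q1] := Q01 i s; rewrite ger0_norm//.
  by rewrite (le_trans _ (psic s))// ler_piMl.
rewrite (Ex_coder_tree Q01 f1c) (Ex_coder_tree Q01 f2c).
have : forall n j s, (j + n = i)%N -> tree Q f1 n j s = tree Q f2 n j s.
  elim=> [|n IH] j s ji /=.
    by rewrite /f1 /f2 -ji addn0 /=; ring.
  by rewrite !IH// addSn -addnS.
by apply; rewrite add0n.
Qed.

End coder.

(** * The hierarchical model *)

Definition config (V : finType) : Type := {set V} -> nat -> bool.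

Definition set_config (V : finType) (w : config V) (B : {set V}) (s : nat -> bool) :
  config V := fun B' => if B' == B then s else w B'.

Section measurability.
Context {R : realType} {d : measure_display} {T : measurableType d}.

Definition mconfig (V : finType) (w : T -> config V) : Prop :=
  forall B i, measurable_fun [set: T] (fun x => w x B i).

Lemma bmeas_finite (I : finType) (h : T -> I) (g : I -> R) :
  (forall a, measurable_fun [set: T] (fun x => h x == a)) ->
  bmeas (fun x => g (h x)).
Proof.
move=> mh; split; last first.
  exists (\sum_a `|g a|) => x; rewrite (bigD1 (h x)) //= lerDl.
  by apply: sumr_ge0 => a _; exact: normr_ge0.
rewrite (_ : (fun x => _) = fun x => \sum_a g a * (h x == a)%:R).
  apply: measurable_sum => a; apply: measurable_funM; first exact: measurable_cst.
  by have [] := bmeas_bool (R := R) (mh a).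
apply/funext => x; rewrite (bigD1 (h x)) //= eqxx mulr1 big1 ?addr0// => a ax.
by rewrite eq_sym (negbTE ax) mulr0.
Qed.

Lemma measurable_all (I : Type) (s : seq I) (b : I -> T -> bool) :
  (forall i, measurable_fun [set: T] (b i)) ->
  measurable_fun [set: T] (fun x => all (b ^~ x) s).
Proof.
move=> mb; elim: s => [|i s IH] /=; first exact: measurable_cst.
exact: measurable_and.
Qed.

Lemma bmeas_pat (V : finType) (M : nat) (w : T -> config V)
    (g : {set {set (V + 'I_M)}} -> R) :
  mconfig w -> bmeas (fun x => g (pat M (w x))).
Proof.
move=> mw; apply: bmeas_finite => S.
rewrite (_ : (fun x => _) = (fun x =>
   all (fun A => w x (key A).1 (key A).2 == (A \in S)) (enum {set V + 'I_M}))).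
  apply: measurable_all => A; case: (A \in S).
    by under eq_fun do rewrite eqb_id; exact: mw.
  by under eq_fun do rewrite eqbF_neg; apply: measurable_neg; exact: mw.
apply/funext => x; apply/eqP/allP => [<- A _|h]; first by rewrite inE.
by apply/setP => A; rewrite inE; apply/eqP/h; rewrite mem_enum.
Qed.

Lemma measurable_coder (u : T -> R) (Q : T -> nat -> (nat -> bool) -> R) i :
  measurable_fun [set: T] u ->
  (forall j (s : T -> nat -> bool),
    (forall n, measurable_fun [set: T] (fun x => s x n)) ->
    measurable_fun [set: T] (fun x => Q x j (s x))) ->
  measurable_fun [set: T] (fun x => coder (u x) (Q x) i).
Proof.
move=> mu mQ; pose st x := coder_state (u x) (Q x).
have mbit n : (forall j, measurable_fun [set: T] (fun x => (st x n).1.1 j)) ->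
    measurable_fun [set: T] (fun x => (st x n).1.2) ->
    measurable_fun [set: T] (fun x => (st x n).2) ->
    measurable_fun [set: T] (fun x => coder_bit (u x) (Q x) n (st x n)).
  move=> ms ml mr; apply: measurable_fun_ltr => //; apply: measurable_funD => //.
  by apply: measurable_funM => //; exact: mQ.
suff [ms ml mr] : [/\ forall j, measurable_fun [set: T] (fun x => (st x i).1.1 j),
    measurable_fun [set: T] (fun x => (st x i).1.2) &
    measurable_fun [set: T] (fun x => (st x i).2)] by exact: mbit.
elim: i => [|n [ms ml mr]].
  by split=> [j||]; rewrite /st/=; exact: measurable_cst.
have mb := mbit n ms ml mr.
have mq := mQ n _ ms.
have stS x : st x n.+1 = coder_step (u x) (Q x) (st x n) n by exact: coder_stateS.
split=> [j||].
- rewrite (_ : (fun x => _) = (fun x => if coder_bit (u x) (Q x) n (st x n)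
    then set_bit (st x n).1.1 n true j else set_bit (st x n).1.1 n false j)).
    by apply: measurable_fun_ifT => //; rewrite /set_bit; case: eqP => _ //;
      exact: measurable_cst.
  by apply/funext => x; rewrite stS /coder_step; case: ifP.
- rewrite (_ : (fun x => _) = (fun x => if coder_bit (u x) (Q x) n (st x n)
    then (st x n).1.2 else (st x n).1.2 + (st x n).2 * Q x n (st x n).1.1)).
    apply: measurable_fun_ifT => //; apply: measurable_funD => //.
    exact: measurable_funM.
  by apply/funext => x; rewrite stS /coder_step; case: ifP.
- rewrite (_ : (fun x => _) = (fun x => if coder_bit (u x) (Q x) n (st x n)
    then (st x n).2 * Q x n (st x n).1.1
    else (st x n).2 * (1 - Q x n (st x n).1.1))).
    apply: measurable_fun_ifT => //; apply: measurable_funM => //.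
    by apply: measurable_funB => //; exact: measurable_cst.
  by apply/funext => x; rewrite stS /coder_step; case: ifP.
Qed.

End measurability.

Lemma eq_pat (V : finType) (M : nat) (P : pred ({set V} * nat)) (w w' : config V) :
  (forall K, P K -> w K.1 K.2 = w' K.1 K.2) ->
  (pat M w :&: keyset P)%SET = (pat M w' :&: keyset P)%SET.
Proof.
move=> ww'; apply/setP => A; rewrite !inE.
by case: (boolP (P (key A))) => [/ww' ->|]; rewrite ?andbF.
Qed.

Section representation.
Variables (R : realType) (L : exchangeable_law R).

(** A number of spare vertices beyond which the error of prediction drops by very little;
    it is chosen for the full set of ['I_j] so that it is the same for all [B] with [j]
    elements, in any vertex set. *)
Definition scale_spec (j i m N : nat) : Prop :=
  realized N i /\ forall M, (N <= M)%N ->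
    err L N [set: 'I_j]%SET i - err L M [set: 'I_j]%SET i <= 16^-1 ^+ m.

Lemma scale_spec_ex j i m : (exists M, realized M i) -> exists N, scale_spec j i m N.
Proof.
move=> [M0 r0]; pose E := [set err L M [set: 'I_j]%SET i | M in [set M | (M0 <= M)%N]].
have hE : has_inf E.
  split; first by exists (err L M0 [set: 'I_j]%SET i); exists M0 => /=.
  by exists 0 => _ [M _ <-]; exact: err_ge0.
have e0 : 0 < 16^-1 ^+ m :> R by rewrite exprn_gt0// invr_gt0.
have [_ [N M0N <-] Nlt] := inf_adherent e0 hE.
have rN := realized_widen M0N r0.
exists N; split=> // M NM.
have infM : inf E <= err L M [set: 'I_j]%SET i.
  by apply: ge_inf; [have [] := hE|exists M => //=; exact: leq_trans NM].
by rewrite lerBlDr (le_trans (ltW Nlt))// addrC lerD2l.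
Qed.

Definition scale0 (j i m : nat) : nat := xget 0%N [set N | scale_spec j i m N].

(** The maximum makes the sequence monotone and [m] makes it tend to infinity. *)
Definition scale (j i m : nat) : nat := (\max_(m' < m.+1) scale0 j i m' + m)%N.

Lemma scale_ge j i m : (m <= scale j i m)%N.
Proof. exact: leq_addl. Qed.

Lemma scaleS j i m : (scale j i m <= scale j i m.+1)%N.
Proof.
rewrite /scale [X in (_ <= X + _)%N]big_ord_recr /= addnS leqW// leq_add2r.
exact: leq_maxl.
Qed.

Lemma scaleP j i m : (exists M, realized M i) -> scale_spec j i m (scale j i m).
Proof.
move=> ri; have [N hN] := scale_spec_ex j m ri.
have : scale_spec j i m (scale0 j i m) by apply: xgetI hN.
have le0 : (scale0 j i m <= scale j i m)%N.
  apply: leq_trans (leq_addr _ _).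
  exact: (@leq_bigmax _ (fun m' : 'I_m.+1 => scale0 j i m') ord_max).
move=> [r h]; split; first exact: (realized_widen le0).
move=> M hM; apply: le_trans (h M (leq_trans le0 hM)).
by rewrite lerD2r; exact: err_widen.
Qed.

Definition approx_prob (V : finType) (B : {set V}) (i m : nat) (w : config V) : R :=
  pcond L B i (pat (scale #|B| i m) w :&: keyset (past B i))%SET.

(** The limit of the finite conditional probabilities along the sequence [scale]. It exists
    almost everywhere only; the upper limit and the truncation to [0, 1] give a function
    that is measurable, bounded and natural in [V] everywhere. *)
Definition bit_prob (V : finType) (B : {set V}) (i : nat) (w : config V) : R :=
  Num.min 1 (Num.max 0 (fine (limn_esup (fun m => (approx_prob B i m w)%:E)))).

Lemma approx_itv (V : finType) (B : {set V}) i m w : 0 <= approx_prob B i m w <= 1.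
Proof. exact: pcond_itv. Qed.

Lemma bit_prob_itv (V : finType) (B : {set V}) i w : 0 <= bit_prob B i w <= 1.
Proof. by rewrite /bit_prob le_min ler01 le_max lexx ge_min lexx. Qed.

Lemma bit_prob_ext (V : finType) (B : {set V}) i (w w' : config V) :
  (forall K, past B i K -> w K.1 K.2 = w' K.1 K.2) -> bit_prob B i w = bit_prob B i w'.
Proof.
by move=> ww'; rewrite /bit_prob /approx_prob; under eq_fun do rewrite (eq_pat _ ww').
Qed.

Lemma bit_prob_natural (V V' : finType) (e : V -> V') (B : {set V}) i (w : config V') :
  injective e ->
  bit_prob (e @: B) i w = bit_prob B i (fun B' : {set V} => w (e @: B')).
Proof.
move=> e_inj; rewrite /bit_prob /approx_prob card_imset//.
by under eq_fun do rewrite pcond_pat_natural//.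
Qed.

Lemma measurable_approx {d} {T : measurableType d} (V : finType) (B : {set V}) i m
    (w : T -> config V) :
  mconfig w -> measurable_fun [set: T] (fun x => approx_prob B i m (w x)).
Proof.
move=> mw; pose g (S : {set {set (V + 'I_(scale #|B| i m))}}) : R :=
  pcond L B i (S :&: keyset (past B i))%SET.
by have [] := bmeas_pat g mw.
Qed.

Lemma measurable_bit_prob {d} {T : measurableType d} (V : finType) (B : {set V}) i
    (w : T -> config V) :
  mconfig w -> measurable_fun [set: T] (fun x => bit_prob B i (w x)).
Proof.
move=> mw; apply: measurable_minr; first exact: measurable_cst.
apply: measurable_maxr; first exact: measurable_cst.
apply: (measurableT_comp (f := fine)) => //.
apply: measurable_fun_limn_esup => m; apply/measurable_EFinP.
exact: measurable_approx.
Qed.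

(** The colours of all sets with fewer than [j] elements, as functions of independent
    uniform variables: the colour of [B] is coded by [x B] with the conditional probabilities
    determined by the colours of the proper subsets of [B]. Larger sets get no colour. *)
Fixpoint model (V : finType) (j : nat) (x : point R {set V}) : config V :=
  match j with
  | 0 => fun _ _ => false
  | j'.+1 => fun B =>
      if #|B| == j'
      then coder (x B) (fun i s => bit_prob B i (set_config (model j' x) B s))
      else model j' x B
  end.

Lemma set_config_natural (V V' : finType) (e : V -> V') (w : config V') (B : {set V}) s :
  injective e ->
  (fun B' : {set V} => set_config w (e @: B) s (e @: B')) =
  set_config (fun B' : {set V} => w (e @: B')) B s.
Proof.
move=> e_inj; apply/funext => B'; rewrite /set_config.
by rewrite (inj_eq (imset_inj e_inj)).
Qed.

Lemma model_natural (V V' : finType) (e : V -> V') j (x : point R {set V'}) (B : {set V}) :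
  injective e ->
  model j x (e @: B) = model j (reindex_point (fun B' : {set V} => e @: B') x) B.
Proof.
move=> e_inj; elim: j B => [//|j IH] B /=.
rewrite (card_imset B e_inj).
case: (#|B| == j); last exact: IH.
rewrite [reindex_point _ _ _]ffunE.
apply: (f_equal (coder (x (e @: B)))).
apply/funext => i; apply/funext => s.
rewrite (bit_prob_natural B i _ e_inj) (set_config_natural (model j x) B s e_inj).
by apply: (f_equal (fun w => bit_prob B i (set_config w B s))); apply/funext.
Qed.

Section model.
Variable V : finType.
Implicit Types (x : point R {set V}) (B : {set V}).

Lemma mconfig_model j : mconfig (fun x => model j x).
Proof.
elim: j => [|j IH] B i /=; first exact: measurable_cst.
case: (#|B| == j); last exact: IH.
apply: (@measurable_coder _ _ _ (fun x : point R {set V} => x B)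
  (fun x i s => bit_prob B i (set_config (model j x) B s))).
  exact: measurable_coord.
move=> n s ms.
have mw : mconfig (fun x => set_config (model j x) B (s x)).
  by move=> B' i'; rewrite /set_config; case: (B' == B); [exact: ms|exact: IH].
exact: (measurable_bit_prob B n mw).
Qed.

Lemma model_stable j j' x B : (#|B| < j)%N -> (j <= j')%N -> model j' x B = model j x B.
Proof.
move=> Bj; elim: j' => [|j' IH]; first by rewrite leqn0 => /eqP ->.
rewrite leq_eqVlt => /orP[/eqP <-//|jj'].
by rewrite /= ltn_eqF ?IH// (leq_trans Bj).
Qed.

Lemma model_fix j x B : (#|B| < j)%N ->
  model j x B = coder (x B) (fun i s => bit_prob B i (set_config (model j x) B s)).
Proof.
move=> Bj; rewrite (model_stable x (ltnSn _) Bj) /= eqxx; apply: (f_equal (coder (x B))).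
apply/funext => i; apply/funext => s; apply: bit_prob_ext => -[B' i'] /=.
rewrite /set_config; case: eqP => // B'B /orP[/= pB|/andP[/= /eqP //]].
by rewrite (model_stable x (proper_card pB))// ltnW.
Qed.

(** The colour of [B'] only depends on the coordinates of the subsets of [B']. *)
Lemma model_upd j x B t B' : ~~ (B \subset B') -> model j (upd x B t) B' = model j x B'.
Proof.
elim: j B' => //= j IH B' BB'; case: (#|B'| == j); last exact: IH.
have B'B : B' != B by apply: contra BB' => /eqP ->.
rewrite [upd _ _ _ _]ffunE (negbTE B'B); apply: (f_equal (coder (x B'))).
apply/funext => i; apply/funext => s; apply: bit_prob_ext => -[B2 i2] /=.
rewrite /set_config; case: eqP => // _ /orP[/= pB|/andP[/= /eqP //]].
rewrite IH//; apply: contra BB' => h; exact: fintype.subset_trans h (proper_sub pB).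
Qed.

End model.
End representation.

(** * The model has the limiting law *)

Section fast_convergence.
Context {R : realType} {d : measure_display} {T : measurableType d}.
Variable P : probability T R.

(** Summable increments in mean are summable almost everywhere, by monotone convergence. *)
Lemma ae_cvg_of_fast_L1 (f : nat -> T -> R) :
  (forall m, bmeas (f m)) ->
  (forall m, Ex P (fun x => `|f m.+1 x - f m x|) <= 2^-1 ^+ m) ->
  {ae P, forall x, cvgn (f ^~ x)}.
Proof.
move=> bf Ef; pose g m x := `|f m.+1 x - f m x|.
have bg m : bmeas (g m) by apply: bmeas_norm; exact: bmeasB.
have mg m : measurable_fun setT (fun x => (g m x)%:E).
  by apply/measurable_EFinP; have [] := bg m.
pose G x := (\sum_(m <oo) (g m x)%:E)%E.
have iG : P.-integrable setT G.
  apply/integrableP; split.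
    by apply: ge0_emeasurable_sum => // m x _ _; rewrite lee_fin normr_ge0.
  rewrite (eq_integral G); last first.
    move=> x _; rewrite /= gee0_abs//.
    by apply: nneseries_ge0 => m _ _; rewrite lee_fin normr_ge0.
  rewrite integral_nneseries//; last by move=> m x _; rewrite lee_fin normr_ge0.
  apply: (@le_lt_trans _ _ (\sum_(m <oo) (2^-1 ^+ m : R)%:E)%E).
    apply: lee_nneseries => m _; last first.
      by rewrite (EFin_Ex P (bg m)) lee_fin; exact: Ef.
    by move=> _; apply: integral_ge0 => x _; rewrite lee_fin normr_ge0.
  have -> : (\sum_(m <oo) ((2^-1 ^+ m : R)%:E))%E = (2 : R)%:E; last by rewrite ltry.
  apply/cvg_lim => //; have := @cvg_geometric_eseries_half R 2 0.
  rewrite expr0 divr1; apply: cvg_trans; apply: near_eq_cvg; apply: nearW => n.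
  apply: eq_bigr => m _; rewrite addn1 natrX exprS invfM mulrA divff ?mul1r ?exprVn//.
apply: filterS (integrable_ae measurableT iG) => x /(_ I) Gx.
have cs : cvgn (series (fun m => g m x)).
  apply: nondecreasing_is_cvgn.
    by apply: nondecreasing_series => m _ _; exact: normr_ge0.
  exists (fine (G x)) => _ [n _ <-]; rewrite -lee_fin fineK// /series/= -sumEFin.
  by apply: nneseries_lim_ge => m _ _; rewrite lee_fin normr_ge0.
have ct : cvgn (series (telescope (f ^~ x))) by apply: normed_cvg.
rewrite (_ : f ^~ x = fun n => f 0%N x + series (telescope (f ^~ x)) n).
  by apply: is_cvgD => //; exact: is_cvg_cst.
by apply/funext => n; exact: (eq_sum_telescope (f ^~ x) n).
Qed.

End fast_convergence.

Section hits.
Variables (R : realType) (V : finType) (M : nat).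
Implicit Types (S : {set {set (V + 'I_M)}}) (P : pred ({set V} * nat)).

Definition hits (T : seq {set V}) S : R := \prod_(A <- T) (hit A 0 S)%:R.

Lemma hit_keyset P B i S : P (B, i) -> hit B i (S :&: keyset P)%SET = hit B i S.
Proof.
move=> PBi; apply/exists_inP/exists_inP => -[A AS kA].
  by exists A => //; move: AS; rewrite inE => /andP[].
by exists A => //; rewrite inE AS inE (eqP kA) PBi.
Qed.

Lemma hits_keyset P T S : (forall A, A \in T -> P (A, 0%N)) ->
  hits T (S :&: keyset P)%SET = hits T S.
Proof.
by move=> h; rewrite /hits big_seq [RHS]big_seq; apply: eq_bigr => A /h /hit_keyset ->.
Qed.

Lemma hits_itv T S : 0 <= hits T S <= 1.
Proof.
rewrite /hits; elim: T => [|A T /andP[h0 h1]]; first by rewrite big_nil lexx ler01.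
by rewrite big_cons; case: (hit _ _ _); rewrite ?mul1r ?mul0r ?h0 ?h1 ?lexx ?ler01.
Qed.

Lemma keysetI_sub P P' S : (forall K, P K -> P' K) ->
  (S :&: keyset P' :&: keyset P)%SET = (S :&: keyset P)%SET.
Proof.
move=> PP'; apply/setP => A; rewrite !inE.
by case: (boolP (P (key A))) => [/PP' ->|_]; rewrite ?andbT ?andbF.
Qed.

End hits.

Lemma realized0 M : realized M 0.
Proof. by apply/existsP; exists finset.set0; rewrite spare_code0. Qed.

Section agreement.
Variables (R : realType) (L : exchangeable_law R) (V : finType) (k : nat).
Let mu := cube_uniform R {set V}.
Local Notation Y := (@model R L V k).

Definition weight (T : seq {set V}) (x : point R {set V}) : R :=
  \prod_(A <- T) bit_prob L A 0 (Y x).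

(** The model reproduces the limiting law on the bits in [P], jointly with the edges in [T].
    The latter have [k] elements; the model does not decide them, it only provides their
    conditional probabilities. *)
Definition agree (P : pred ({set V} * nat)) (T : seq {set V}) : Prop :=
  forall M (G : {set {set (V + 'I_M)}} -> R),
    Ex mu (fun x => G (pat M (Y x) :&: keyset P)%SET * weight T x) =
    mean L (fun S => G (S :&: keyset P)%SET * hits R T S).

Lemma mconfig_Y : mconfig Y.
Proof. exact: mconfig_model. Qed.

Lemma bmeas_bit_prob B i : bmeas (fun x => bit_prob L B i (Y x)).
Proof.
by apply: bmeas01 => [|x]; [exact: (measurable_bit_prob L B i mconfig_Y)|exact: bit_prob_itv].
Qed.

Lemma bmeas_weight T : bmeas (weight T).
Proof. by apply: bmeas_prod => A _; exact: bmeas_bit_prob. Qed.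

Lemma bmeas_pattern M (G : {set {set (V + 'I_M)}} -> R) P :
  bmeas (fun x => G (pat M (Y x) :&: keyset P)%SET).
Proof. exact: (bmeas_pat (fun S => G (S :&: keyset P)%SET) mconfig_Y). Qed.

Lemma bmeas_approx B i m : bmeas (fun x => approx_prob L B i m (Y x)).
Proof.
by apply: bmeas01 => [|x]; [exact: (measurable_approx L B i m mconfig_Y)|exact: approx_itv].
Qed.

Lemma weight_itv T x : 0 <= weight T x <= 1.
Proof.
rewrite /weight; elim: T => [|A T /andP[h0 h1]]; first by rewrite big_nil lexx ler01.
have /andP[q0 q1] := bit_prob_itv L A 0 (Y x).
by rewrite big_cons mulr_ge0//= mulr_ile1.
Qed.

Lemma scale_spec_card (B : {set V}) i m : (exists M, realized M i) ->
  realized (scale L #|B| i m) i /\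
  forall M, (scale L #|B| i m <= M)%N ->
    err L (scale L #|B| i m) B i - err L M B i <= 16^-1 ^+ m.
Proof.
move=> ri; have [r h] := scaleP L #|B| m ri; split=> // M hM.
pose e : 'I_#|B| -> V := enum_val.
have e_inj : injective e by exact: enum_val_inj.
have eB : e @: [set: 'I_#|B|]%SET = B.
  apply/setP => v; apply/imsetP/idP => [[j _ ->]|vB]; first exact: enum_valP.
  by exists (enum_rank_in vB v); rewrite ?inE// /e enum_rankK_in.
have errE N : err L N B i = err L N [set: 'I_#|B|]%SET i.
  by rewrite -(err_natural L N e_inj) eB.
by rewrite !errE; exact: h.
Qed.

Section past_known.
Variables (P : pred ({set V} * nat)) (B : {set V}) (i : nat).
Hypothesis pastP : forall K, past B i K -> P K.

Lemma approx_mean T m M (leM : (M <= scale L #|B| i m)%N)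
    (G : {set {set (V + 'I_M)}} -> R) : agree P T ->
  Ex mu (fun x => approx_prob L B i m (Y x) * G (pat M (Y x) :&: keyset P)%SET
                  * weight T x) =
  mean L (fun S => pcond L B i (S :&: keyset (past B i))%SET *
     G (pullback (widen leM) S :&: keyset P)%SET * hits R T S).
Proof.
move=> /(_ _ (fun S => pcond L B i (S :&: keyset (past B i))%SET *
     G (pullback (widen leM) S :&: keyset P)%SET)) h.
transitivity (mean L (fun S : {set {set (V + 'I_(scale L #|B| i m))}} =>
  (pcond L B i (S :&: keyset P :&: keyset (past B i))%SET *
     G (pullback (widen leM) (S :&: keyset P)%SET :&: keyset P)%SET) * hits R T S)).
  rewrite -h; congr Ex; apply/funext => x; congr (_ * _).
  by rewrite keysetI_sub// pullback_widen_keyset -finset.setIA finset.setIid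
     pullback_widen_pat.
congr mean; apply/funext => S; congr (_ * _).
by rewrite keysetI_sub// pullback_widen_keyset -finset.setIA finset.setIid.
Qed.

Lemma weight_nil x : weight [::] x = 1.
Proof. by rewrite /weight big_nil. Qed.

Lemma hits_nil M (S : {set {set (V + 'I_M)}}) : hits R [::] S = 1.
Proof. by rewrite /hits big_nil. Qed.

(** In mean square the increment is a difference of errors, hence at most [16 ^- m] by the
    choice of [scale]; the comparison with the absolute value uses
    [2 * u <= q * u ^+ 2 + q^-1] for [q = 4 ^+ m]. *)
Lemma Ex_approx_increment m : agree P [::] -> (exists M, realized M i) ->
  Ex mu (fun x => `|approx_prob L B i m.+1 (Y x) - approx_prob L B i m (Y x)|)
  <= 2^-1 ^+ m.
Proof.
move=> agP ri; have [r h] := scale_spec_card B m ri.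
have leS := scaleS L #|B| i m.
pose D (S : {set {set (V + 'I_(scale L #|B| i m.+1))}}) : R :=
  pcond L B i (S :&: keyset (past B i))%SET -
  pcond L B i (pullback (widen leS) S :&: keyset (past B i))%SET.
have DP S : D (S :&: keyset P)%SET = D S.
  by rewrite /D pullback_widen_keyset !keysetI_sub.
rewrite (_ : Ex _ _ = mean L (fun S => `|D S|)); last first.
  have := agP _ (fun S => `|D S|).
  under eq_fun do rewrite weight_nil mulr1 DP.
  under [in X in _ = X -> _]eq_fun do rewrite hits_nil mulr1 DP.
  move=> <-; congr Ex; apply/funext => x.
  by rewrite /D pullback_widen_pat.
apply: (@le_trans _ _ (mean L (fun S => 2^-1 * (4 ^+ m * D S ^+ 2 + 4^-1 ^+ m)))).
  apply: le_mean => S.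
  have q0 : 0 < 4 ^+ m :> R by rewrite exprn_gt0.
  have -> : 4^-1 ^+ m = (4 ^+ m)^-1 :> R by rewrite exprVn.
  rewrite -[D S ^+ 2]real_normK ?num_real//.
  have : 0 <= (4 ^+ m)^-1 * (4 ^+ m * `|D S| - 1) ^+ 2.
    by rewrite mulr_ge0 ?sqr_ge0// invr_ge0 ltW.
  have -> : (4 ^+ m)^-1 * (4 ^+ m * `|D S| - 1) ^+ 2 =
      4 ^+ m * `|D S| ^+ 2 - 2 * `|D S| + (4 ^+ m)^-1.
    by field; rewrite gt_eqF.
  by move: (4 ^+ m * `|D S| ^+ 2) => ?; move: `|D S| (4 ^+ m)^-1 => ? ?; lra.
rewrite meanZ meanD meanZ mean_cst mean_sqr_pcondB//.
apply: (@le_trans _ _ (4^-1 ^+ m)).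
  have q0 : 0 <= 4 ^+ m :> R by rewrite exprn_ge0.
  have := ler_wpM2l q0 (h _ leS).
  rewrite -exprMn (_ : 4 * 16^-1 = 4^-1); last by field.
  by move: (4 ^+ m * _) (4^-1 ^+ m) => ? ?; lra.
by rewrite lerXn2r// ?nnegrE ?invr_ge0// lef_pV2// ?posrE// ler_nat.
Qed.

Lemma approx_cvg : agree P [::] -> (exists M, realized M i) ->
  {ae mu, forall x, (fun m => approx_prob L B i m (Y x)) @ \oo --> bit_prob L B i (Y x)}.
Proof.
move=> agP ri.
apply: filterS (ae_cvg_of_fast_L1 (fun m => bmeas_approx B i m)
  (fun m => Ex_approx_increment m agP ri)) => x cx.
suff <- : limn (fun m => approx_prob L B i m (Y x)) = bit_prob L B i (Y x) by [].
rewrite /bit_prob; set u := fun m => approx_prob L B i m (Y x).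
have -> : limn_esup (fun m => (u m)%:E) = (limn u)%:E.
  have cu : (fun m => (u m)%:E) @ \oo --> (limn u)%:E.
    by apply: cvg_EFin => //; exact: nearW.
  by rewrite is_cvg_limn_esupE; [exact/cvg_lim|apply/cvg_ex; eexists; exact: cu].
have l0 : 0 <= limn u.
  by apply: limr_ge => //; apply: nearW => m; have /andP[] := approx_itv L B i m (Y x).
have l1 : limn u <= 1.
  by apply: limr_le => //; apply: nearW => m; have /andP[] := approx_itv L B i m (Y x).
by rewrite /= (max_idPr l0) (min_idPr l1).
Qed.

(** The heart of the induction. In the model, [bit_prob] is the limit of [approx_prob], which
    is a function of finitely many bits in [P], so that the model may be replaced by the
    limiting law; there, by conditional independence, [approx_prob] may be replaced by
    the bit itself, up to an error that tends to 0. *)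
Lemma bit_prob_step (T : seq {set V}) M (G : {set {set (V + 'I_M)}} -> R) :
  (forall K, P K -> side B i K) -> (forall A, A \in T -> ~~ (B \subset A)) ->
  agree P [::] -> agree P T -> realized M i ->
  Ex mu (fun x => bit_prob L B i (Y x) * G (pat M (Y x) :&: keyset P)%SET
                  * weight T x) =
  mean L (fun S => (hit B i S)%:R * G (S :&: keyset P)%SET * hits R T S).
Proof.
move=> sideP sideT agP agT rM; have ri : exists M, realized M i by exists M.
(* A bound on G that is also positive, so that G can be normalized. *)
pose c := 1 + \sum_S `|G S|.
have c0 : 0 < c by rewrite ltr_wpDr// sumr_ge0.
have Gc S : `|G S| <= c.
  by rewrite /c (bigD1 S)//= addrCA lerDl addr_ge0// sumr_ge0.
set target := mean L _.
pose a m := Ex mu (fun x => approx_prob L B i m (Y x) *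
  G (pat M (Y x) :&: keyset P)%SET * weight T x).
have cvga : a @ \oo --> Ex mu (fun x => bit_prob L B i (Y x) *
    G (pat M (Y x) :&: keyset P)%SET * weight T x).
  have bGw : bmeas (fun x => G (pat M (Y x) :&: keyset P)%SET * weight T x).
    by apply: bmeasM; [exact: bmeas_pattern|exact: bmeas_weight].
  apply: (@Ex_dominated _ _ _ _ _ _ c).
  - move=> m; under eq_fun do rewrite -mulrA.
    by have [] := bmeasM (bmeas_approx B i m) bGw.
  - under eq_fun do rewrite -mulrA.
    by have [] := bmeasM (bmeas_bit_prob B i) bGw.
  - move=> m x.
    have /andP[p0 p1] := approx_itv L B i m (Y x).
    have /andP[w0 w1] := weight_itv T x.
    rewrite (normrM (approx_prob L B i m (Y x) * _)).
    rewrite (normrM (approx_prob L B i m (Y x))) (ger0_norm p0) (ger0_norm w0).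
    rewrite [leRHS](_ : c = 1 * c * 1); last by rewrite mul1r mulr1.
    apply: ler_pM => //; [by rewrite mulr_ge0|exact: ler_pM].
  - apply: filterS (approx_cvg agP ri) => x cx.
    by apply: cvgMr_tmp; apply: cvgMr_tmp.
have am m : (M <= m)%N -> `|a m - target| <= c * 4^-1 ^+ m.
  move=> Mm; have leM : (M <= scale L #|B| i m)%N := leq_trans Mm (scale_ge L #|B| i m).
  rewrite /a (approx_mean leM)//.
  pose g (S : {set {set (V + 'I_(scale L #|B| i m))}}) : R :=
    c^-1 * G (pullback (widen leM) S :&: keyset P)%SET * hits R T S.
  have g1 S : `|g S| <= 1.
    rewrite /g !normrM; have /andP[h0 h1] := hits_itv R T S.
    rewrite (ger0_norm h0) mulr_ile1// ?mulr_ge0//.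
    by rewrite (gtr0_norm (_ : 0 < c^-1)) ?invr_gt0// mulrC ler_pdivrMr// mul1r.
  have [rS hS] := scale_spec_card B m ri.
  have := conditional_independence L B rS g1.
  move=> /le_trans /(_ (hS _ (leq_addr _ _))).
  have gside S : g (S :&: keyset (side B i))%SET = g S.
    rewrite /g pullback_widen_keyset keysetI_sub// hits_keyset// => A /sideT nA.
    by rewrite /side /= nA.
  under eq_fun do rewrite gside.
  rewrite (_ : mean L _ = c^-1 * (target - mean L (fun S =>
      pcond L B i (S :&: keyset (past B i))%SET *
      G (pullback (widen leM) S :&: keyset P)%SET * hits R T S))); last first.
    rewrite /target (mean_pullback L _ (@widen_inj V _ _ leM)) -meanB -meanZ.
    congr mean; apply/funext => S; rewrite hit_widen//.
    rewrite (_ : hits R T (pullback (widen leM) S) = hits R T S); last first.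
      by apply: eq_bigr => A _; rewrite hit_widen// realized0.
    by rewrite /g; ring.
  move=> hsq; rewrite distrC -ler_pdivrMl// -[c^-1]gtr0_norm ?invr_gt0// -normrM.
  rewrite -[leRHS]ger0_norm ?exprn_ge0 ?invr_ge0// -ler_sqr ?nnegrE//.
  by rewrite !real_normK ?num_real// -exprM mulnC exprM (_ : 4^-1 ^+ 2 = 16^-1) //; field.
apply: (norm_cvg_unique cvga).
have c4 : (fun m => c * 4^-1 ^+ m) @ \oo --> (0 : R).
  by apply: (@cvg_geometric R c 4^-1); rewrite ger0_norm ?invr_ge0// invf_lt1 ?ltr1n.
apply/subr_cvg0/norm_cvg0P.
apply: (squeeze_cvgr _ (cvg_cst 0) c4).
by near=> m; rewrite normr_ge0 /= am//; near: m; exact: nbhs_infty_ge.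
Unshelve. all: by end_near.
Qed.

End past_known.

(** Resample the coordinate of [B]: bits on the side of [B] see it through the earlier bits
    of [B] only, and given these the coder produces the next bit with the required
    probability. *)
Lemma fresh_bit (P : pred ({set V} * nat)) (B : {set V}) i M
    (G : {set {set (V + 'I_M)}} -> R) :
  (#|B| < k)%N -> (forall K, P K -> side B i K) ->
  Ex mu (fun x => (Y x B i)%:R * G (pat M (Y x) :&: keyset P)%SET) =
  Ex mu (fun x => bit_prob L B i (Y x) * G (pat M (Y x) :&: keyset P)%SET).
Proof.
move=> Bk sideP; have bG := bmeas_pattern G P.
have bl : bmeas (fun x => (Y x B i)%:R * G (pat M (Y x) :&: keyset P)%SET).
  by apply: bmeasM => //; exact: (bmeas_bool (mconfig_Y B i)).
have br : bmeas (fun x => bit_prob L B i (Y x) * G (pat M (Y x) :&: keyset P)%SET).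
  exact: bmeasM (bmeas_bit_prob B i) bG.
rewrite /mu (Ex_resample B bl) (Ex_resample B br).
congr Ex; apply/funext => x.
pose Q j s := bit_prob L B j (set_config (Y x) B s).
pose psi s := G (pat M (set_config (Y x) B s) :&: keyset P)%SET.
have YB t : Y (upd x B t) B = coder t Q.
  rewrite (model_fix L (upd x B t) Bk) [upd x B t B]ffunE eqxx.
  apply: (f_equal (coder t)).
  apply/funext => j; apply/funext => s; apply: bit_prob_ext => -[B' j'] /= pK.
  rewrite /set_config; case: eqP => // B'B; apply: (f_equal (fun s => s j')); apply: model_upd.
  by have /orP[/=|/andP[/= /eqP]] := past_side pK.
have Yside t K : side B i K ->
    Y (upd x B t) K.1 K.2 = set_config (Y x) B (bits_before (coder t Q) i) K.1 K.2.
  rewrite /set_config /bits_before => /orP[nB|/andP[/eqP KB Ki]].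
    rewrite (model_upd L k x t nB); case: eqP => // KB.
    by rewrite KB fintype.subxx in nB.
  by rewrite KB eqxx YB Ki.
have YG t : G (pat M (Y (upd x B t)) :&: keyset P)%SET = psi (bits_before (coder t Q) i).
  by congr G; apply: eq_pat => K /sideP; exact: Yside.
have Yq t : bit_prob L B i (Y (upd x B t)) = Q i (bits_before (coder t Q) i).
  by apply: bit_prob_ext => K /past_side; exact: Yside.
transitivity (Ex (U01 R) (fun t => (coder t Q i)%:R * psi (bits_before (coder t Q) i))).
  by congr Ex; apply/funext => t; rewrite YG YB.
have psic s : `|psi s| <= \sum_S `|G S|.
  by rewrite /psi; set S := (_ :&: _)%SET; rewrite (bigD1 S)//= lerDl sumr_ge0.
rewrite (Ex_coder i (fun j s => bit_prob_itv L B j _) psic).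
by congr Ex; apply/funext => t; rewrite YG Yq.
Qed.

(** A function of the bits in [P] and of one more bit is affine in the latter. *)
Lemma agree_bit (P : pred ({set V} * nat)) (B : {set V}) i :
  (#|B| < k)%N -> (forall K, past B i K -> P K) -> (forall K, P K -> side B i K) ->
  agree P [::] -> agree (fun K => P K || (K == (B, i))) [::].
Proof.
move=> Bk pastP sideP agP M G; have [rM|nrM] := boolP (realized M i); last first.
  have kE S : (S :&: keyset (fun K => P K || (K == (B, i))))%SET =
      (S :&: keyset P)%SET :> {set {set (V + 'I_M)}}.
    apply/setP => A; rewrite !inE; case: eqP => [kA|]; last by rewrite orbF.
    have /negP[] := nrM; apply/existsP; exists (spare_part A).
    by have [_ ->] := kA.
  under eq_fun do rewrite kE.
  by under [in RHS]eq_fun do rewrite kE; exact: agP.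
have /existsP[C /eqP Ci] := rM; pose A0 := join B C.
have kA0 : key A0 = (B, i) by rewrite /A0 key_join Ci.
pose G1 (Z : {set {set (V + 'I_M)}}) : R := G (A0 |: Z)%SET - G Z.
have GE S : G (S :&: keyset (fun K => P K || (K == (B, i))))%SET =
    (hit B i S)%:R * G1 (S :&: keyset P)%SET + G (S :&: keyset P)%SET.
  rewrite (hitE _ kA0) /G1; case: (boolP (A0 \in S)) => AS; last first.
    rewrite mul0r add0r; congr G; apply/setP => A; rewrite !inE.
    case: (key A =P (B, i)) => [kA|]; last by rewrite orbF.
    have -> : A = A0 by apply: key_inj; rewrite kA kA0.
    by rewrite (negbTE AS).
  rewrite mul1r subrK; congr G; apply/setP => A; rewrite !inE.
  have -> : (A == A0) = (key A == (B, i)) by rewrite -kA0 (inj_eq (@key_inj _ _)).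
  case: (key A =P (B, i)) => [kA|]; last by rewrite orbF.
  have -> : A = A0 by apply: key_inj; rewrite kA kA0.
  by rewrite AS orbT.
have hY x : hit B i (pat M (Y x)) = Y x B i by rewrite (hitE _ kA0) inE kA0.
under eq_fun do rewrite weight_nil mulr1 GE hY.
under [in RHS]eq_fun do rewrite hits_nil mulr1 GE.
have bG := bmeas_pattern G P; have bG1 := bmeas_pattern G1 P.
rewrite meanD ExD//; last by apply: bmeasM => //; exact: (bmeas_bool (mconfig_Y B i)).
congr (_ + _).
  rewrite fresh_bit//.
  have nilT (A : {set V}) : A \in [::] -> ~~ (B \subset A) by rewrite in_nil.
  have := bit_prob_step pastP G1 sideP nilT agP agP rM.
  under eq_fun do rewrite weight_nil mulr1.
  by under [in X in _ = X -> _]eq_fun do rewrite hits_nil mulr1.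
have := agP M G.
under eq_fun do rewrite weight_nil mulr1.
by under [in X in _ = X -> _]eq_fun do rewrite hits_nil mulr1.
Qed.

Lemma agree_eq (P P' : pred ({set V} * nat)) T : P =1 P' -> agree P T -> agree P' T.
Proof. by move=> /funext ->. Qed.

(** The sets are added in order of size, and the bits of each set one by one. A maximal
    element of a lower set is contained in no other element, so all the bits added before
    are on its side. *)
Lemma agree_lower_set (D : {set {set V}}) :
  (forall B B' : {set V}, B' \subset B -> B \in D -> B' \in D) ->
  (forall B, B \in D -> (#|B| < k)%N) ->
  agree (fun K => K.1 \in D) [::].
Proof.
have [n] := ubnP #|D|; elim: n D => // n IH D Dn Dlow Dk.
have [D0|[B0 B0D]] := set_0Vmem D.
  move=> M G; have kE S : (S :&: keyset (fun K => K.1 \in D))%SET =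
      finset.set0 :> {set {set (V + 'I_M)}}.
    by apply/setP => A; rewrite !inE D0 inE andbF.
  under eq_fun do rewrite kE weight_nil mulr1.
  under [in RHS]eq_fun do rewrite kE hits_nil mulr1.
  by rewrite Ex_cst mean_cst.
pose B := [arg max_(A > B0 in D) #|A|].
have [BD Bmax] : B \in D /\ forall A, A \in D -> (#|A| <= #|B|)%N.
  by rewrite /B; case: arg_maxnP.
pose D' := (D :\ B)%SET.
have Bsub A : A \in D -> B \subset A -> A = B.
  by move=> AD BA; apply/esym/eqP; rewrite eqEcard BA Bmax.
have agD' : agree (fun K => K.1 \in D') [::].
  apply: IH.
  - by rewrite -ltnS; apply: leq_trans Dn; rewrite [in leqRHS](cardsD1 B) BD.
  - move=> A A' A'A; rewrite !inE => /andP[AB AD]; rewrite (Dlow _ _ A'A AD) andbT.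
    apply: contra AB => /eqP A'B; apply/eqP; apply: Bsub => //.
    by rewrite -A'B.
  - by move=> A; rewrite inE => /andP[_]; exact: Dk.
have agi i : agree (fun K => (K.1 \in D') || ((K.1 == B) && (K.2 < i)%N)) [::].
  elim: i => [|i IHi].
    by apply: agree_eq agD' => K; rewrite ltn0 andbF orbF.
  apply: agree_eq (@agree_bit _ B i (Dk B BD) _ _ IHi).
  - move=> [A j] /=; rewrite [in RHS]ltnS (leq_eqVlt j i) xpair_eqE.
    case: (A \in D') => //=; case: (A == B) => //=.
    by rewrite orbC.
  - move=> [A j] /= /orP[/= AB|/= ->]; last by rewrite orbT.
    rewrite !inE (Dlow _ _ (proper_sub AB) BD) andbT.
    by move: AB; rewrite finset.properEneq => /andP[->].
  - move=> [A j] /= /orP[|h]; last by rewrite /side /= h orbT.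
    rewrite !inE /side /= => /andP[AB AD]; apply/orP; left.
    by apply: contra AB => /(Bsub _ AD) ->.
move=> M G.
(* With M spare vertices only the bits below i of the colour of B are visible. *)
pose i := (\max_(C : {set 'I_M}) spare_code C)%N.+1.
have kE : keyset (fun K => K.1 \in D) =
    keyset (fun K => (K.1 \in D') || ((K.1 == B) && (K.2 < i)%N)) :> {set {set (V + 'I_M)}}.
  apply/setP => A; rewrite !inE /=.
  have -> : (spare_code (spare_part A) < i)%N by rewrite /i ltnS leq_bigmax.
  by rewrite andbT; case: eqP => [->|]; rewrite ?BD ?orbT ?orbF.
by rewrite kE; exact: agi.
Qed.

Definition low : pred ({set V} * nat) := fun K => (#|K.1| < k)%N.

Lemma agree_low (T : seq {set V}) :
  uniq T -> (forall A, A \in T -> #|A| = k) -> agree low T.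
Proof.
have agl : agree low [::].
  apply: (@agree_eq (fun K => K.1 \in [set B : {set V} | (#|B| < k)%N]%SET)).
    by move=> K; rewrite inE.
  apply: agree_lower_set => [B B' B'B|B]; rewrite !inE//.
  by apply: leq_ltn_trans; exact: subset_leq_card.
elim: T => [//|A T IH] /= /andP[AT uT] Tk.
have Ak : #|A| = k by apply: Tk; rewrite mem_head.
have agT : agree low T by apply: IH => // A' A'T; apply: Tk; rewrite in_cons A'T orbT.
have pastL K : past A 0 K -> low K.
  by move=> /orP[/proper_card|/andP[_]//]; rewrite Ak.
have sideL K : low K -> side A 0 K.
  rewrite /low /side => Kk; apply/orP; left; apply: contraTN Kk => /subset_leq_card.
  by rewrite Ak -leqNgt.
move=> M G.
have sideT A' : A' \in T -> ~~ (A \subset A').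
  move=> A'T; apply: contra AT => AA'.
  by have -> : A = A' by apply/eqP; rewrite eqEcard AA' Ak Tk ?leqnn// in_cons A'T orbT.
have h := bit_prob_step pastL G sideL sideT agl agT (realized0 M).
rewrite (_ : (fun x => _) = (fun x => bit_prob L A 0 (Y x) *
    G (pat M (Y x) :&: keyset low)%SET * weight T x)); last first.
  by apply/funext => x; rewrite /weight big_cons; ring.
by rewrite h; congr mean; apply/funext => S; rewrite /hits big_cons; ring.
Qed.

(** The density of [E] is the mean of a product of conditional probabilities; no spare vertex
    is left. *)
Lemma Ex_weight (E : {set {set V}}) : (forall A, A \in E -> #|A| = k) ->
  Ex mu (weight (enum E)) = density L E.
Proof.
move=> Ek; have Ek' A : A \in enum E -> #|A| = k by rewrite mem_enum; exact: Ek.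
have := agree_low (enum_uniq (mem E)) Ek' (fun _ : {set {set (V + 'I_0)}} => 1).
under eq_fun do rewrite mul1r.
under [in X in _ = X -> _]eq_fun do rewrite mul1r.
move=> ->.
have inl_inj : injective (@inl V 'I_0) by move=> a b [].
transitivity (mean L (fun S : {set {set V}} => (E \subset S)%:R)); last first.
  rewrite /mean /density [RHS]big_mkcond; apply: eq_bigr => S _.
  by case: ifP => _; rewrite ?mulr1 ?mulr0.
rewrite (mean_pullback L _ inl_inj); congr mean; apply/funext => S.
have hA A : hit A 0 S = (A \in pullback inl S).
  rewrite inE (@hitE _ _ _ _ _ (inl @: A))//.
  rewrite /key (_ : spare_part _ = finset.set0) ?spare_code0; last by apply/setP => -[].
  congr (_, _); apply/setP => v; rewrite inE mem_imset//.
rewrite /hits; have [/fintype.subsetP ES|/subsetPn[A AE AS]] := boolP (E \subset _).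
  by rewrite big_seq big1// => A; rewrite mem_enum hA => /ES ->.
by rewrite (big_rem A) ?mem_enum//= hA (negbTE AS) mul0r.
Qed.

End agreement.

Section more_expectation.
Context {R : realType} {d : measure_display} {T : measurableType d}.
Variable P : probability T R.

Lemma ae_eq0_of_Ex (f : T -> R) : bmeas f -> (forall x, 0 <= f x) -> Ex P f = 0 ->
  {ae P, forall x, f x = 0}.
Proof.
move=> bf f0 E0; have [mf _] := bf.
have mfE : measurable_fun setT (EFin \o f) by apply/measurable_EFinP.
have /(ae_eq_integral_abs P measurableT mfE) : (\int[P]_x `|(EFin \o f) x| = 0)%E.
  rewrite (eq_integral (fun x => (f x)%:E)); last first.
    by move=> x _; rewrite /= ger0_norm.
  by rewrite EFin_Ex// E0.
by apply: filterS => x /(_ I) /= [].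
Qed.

Lemma ae_exists (Q : T -> Prop) : {ae P, forall x, Q x} -> exists x, Q x.
Proof.
move=> [N [mN N0 sub]]; apply: contrapT => nQ.
have NT : N = setT.
  by apply/seteqP; split=> // x _; apply: sub => /= Qx; apply: nQ; exists x.
have : P setT = 0%E by rewrite -NT.
by rewrite probability_setT => /eqP; rewrite onee_eq0.
Qed.

End more_expectation.

Lemma Ex_swap {R : realType} {d d' : measure_display} {T : measurableType d}
    {T' : measurableType d'} (P : probability T R) (Q : probability T' R)
    (f : T * T' -> R) : bmeas f ->
  Ex P (fun x => Ex Q (fun y => f (x, y))) = Ex Q (fun y => Ex P (fun x => f (x, y))).
Proof.
move=> bf.
have := Fubini (m1 := P) (m2 := Q) (f := EFin \o f) (bmeas_integrable (P \x Q)%E bf).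
rewrite (eq_integral (fun x => (Ex Q (fun y => f (x, y)))%:E)); last first.
  by move=> x _; rewrite EFin_Ex//; apply: (bmeas_comp _ bf); exact: pair1_measurable.
rewrite [in X in _ = X -> _](eq_integral (fun y => (Ex P (fun x => f (x, y)))%:E)); last first.
  by move=> y _; rewrite EFin_Ex//; apply: (bmeas_comp _ bf); exact: pair2_measurable.
by move=> /(congr1 fine).
Qed.

(** * Fibres over the coordinate of the empty set *)

Section disintegration.
Variables (R : realType) (L : exchangeable_law R) (k : nat).
Hypothesis k_gt0 : (0 < k)%N.

Lemma weightE (V : finType) (E : {set {set V}}) x :
  weight L k (enum E) x = \prod_(A in E) bit_prob L A 0 (model L k x).
Proof. by rewrite /weight big_enum. Qed.

Lemma bit_prob_model_natural (V V' : finType) (e : V -> V') (A : {set V}) i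
    (x : point R {set V'}) : injective e ->
  bit_prob L (e @: A) i (model L k x) =
  bit_prob L A i (model L k (reindex_point (fun B : {set V} => e @: B) x)).
Proof.
move=> e_inj; rewrite (bit_prob_natural L A i _ e_inj).
apply: (f_equal (bit_prob L A i)); apply/funext => B.
exact: (model_natural L k x B e_inj).
Qed.

Lemma weight_natural (V V' : finType) (e : V -> V') (E : {set {set V}})
    (x : point R {set V'}) : injective e ->
  weight L k (enum [set e @: A | A : {set V} in E]%SET) x =
  weight L k (enum E) (reindex_point (fun B : {set V} => e @: B) x).
Proof.
move=> e_inj; rewrite !weightE big_imset; last by move=> ? ? _ _; exact: imset_inj.
by apply: eq_bigr => A _; exact: bit_prob_model_natural.
Qed.

Lemma model_local (V : finType) j (x x' : point R {set V}) :
  (forall B : {set V}, (#|B| < j)%N -> x B = x' B) -> model L j x = model L j x'.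
Proof.
elim: j => //= j IH xx'.
have -> : model L j x = model L j x'.
  by apply: IH => B Bj; apply: xx'; exact: ltnW.
apply/funext => B; case: (#|B| =P j) => [Bj|_]; last exact: erefl.
have -> : x B = x' B by apply: xx'; rewrite Bj.
exact: erefl.
Qed.

Lemma reindex_upd0 (V V' : finType) (e : V -> V') (x : point R {set V'}) t :
  reindex_point (fun B : {set V} => e @: B) (upd x finset.set0 t) =
  upd (reindex_point (fun B : {set V} => e @: B) x) finset.set0 t.
Proof. by apply/ffunP => B; rewrite !ffunE imset_eq0. Qed.

(** The mean of the product of conditional probabilities when the coordinate of the empty
    set is fixed to [y]; this will be the density of the hypergraphon of the fibre. *)
Definition fibre_density (V : finType) (E : {set {set V}}) (y : R) : R :=
  Ex (cube_uniform R {set V}) (fun x => weight L k (enum E) (upd x finset.set0 y)).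

Lemma bmeas_weight_upd (V : finType) (E : {set {set V}}) :
  bmeas (fun z : point R {set V} * measurableTypeR R =>
    weight L k (enum E) (upd z.1 finset.set0 z.2)).
Proof. exact: (bmeas_comp (measurable_upd finset.set0) (bmeas_weight L k (enum E))). Qed.

Lemma bmeas_fibre_density (V : finType) (E : {set {set V}}) :
  bmeas (fibre_density E : measurableTypeR R -> R).
Proof.
apply: (bmeas_Ex (U01 R) (cube_uniform R {set V})
  (f := fun z => weight L k (enum E) (upd z.2 finset.set0 z.1))).
have ms : measurable_fun setT
    (fun z : measurableTypeR R * point R {set V} => (z.2, z.1)) by exact: measurable_swap.
exact: (bmeas_comp ms (bmeas_weight_upd E)).
Qed.

Lemma Ex_fibre_density (V : finType) (E : {set {set V}}) :
  (forall A, A \in E -> #|A| = k) -> Ex (U01 R) (fibre_density E) = density L E.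
Proof.
move=> Ek; rewrite -(Ex_weight L Ek).
rewrite (Ex_resample finset.set0 (bmeas_weight L k (enum E))).
by rewrite (Ex_swap _ _ (bmeas_weight_upd E)).
Qed.

Lemma fibre_density_natural (V V' : finType) (e : V -> V') (E : {set {set V}}) y :
  injective e -> fibre_density [set e @: A | A : {set V} in E]%SET y = fibre_density E y.
Proof.
move=> e_inj; rewrite /fibre_density.
under eq_fun do rewrite (weight_natural E _ e_inj) reindex_upd0.
rewrite -(@Ex_reindex _ _ _ (fun B : {set V} => e @: B)
  (fun x => weight L k (enum E) (upd x finset.set0 y)))//; first exact: imset_inj.
by have := bmeas_comp (pair2_measurable y) (bmeas_weight_upd E).
Qed.

(** Completes the coordinates on [Q] to a point on all subsets. The default 0 goes to the
    nonempty sets outside [Q]; in the uses below these have at least [k] elements, and the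
    model does not read their coordinates. *)
Definition extend_point (V : finType) (Q : {set {set V}}) (y : R)
    (x : point R {B : {set V} | B \in Q}) : point R {set V} :=
  [ffun B => if B == finset.set0 then y
             else if insub B is Some b then x b else 0].

Lemma measurable_extend (V : finType) (Q : {set {set V}}) (y : R) :
  measurable_fun setT (extend_point (Q := Q) y).
Proof.
apply: measurable_point => B.
have [B0|B0] := eqVneq B finset.set0.
  apply: (eq_measurable_fun (cst y)); last exact: measurable_cst.
  by move=> z _; rewrite /= ffunE B0 eqxx.
case: (@insubP _ _ {B : {set V} | B \in Q} B) => [b _ bB|BQ].
  apply: (eq_measurable_fun (fun z : point R {B : {set V} | B \in Q} => z b));
    last exact: measurable_coord.
  by move=> z _; rewrite ffunE (negbTE B0) -bB valK.
apply: (eq_measurable_fun (cst (0 : R))); last exact: measurable_cst.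
by move=> z _; rewrite /= ffunE (negbTE B0) insubN.
Qed.

Lemma model_extend (V : finType) (Q : {set {set V}}) (x : point R {set V})
    (y : R) (x' : point R {B : {set V} | B \in Q}) :
  (forall B : {set V}, B != finset.set0 -> (#|B| < k)%N -> B \in Q) ->
  (forall b : {B : {set V} | B \in Q}, x' b = x (val b)) ->
  model L k (extend_point y x') = model L k (upd x finset.set0 y).
Proof.
move=> hQ xx'; apply: model_local => B Bk; rewrite !ffunE.
case: eqP => [//|/eqP B0]; have BQ := hQ B B0 Bk.
by rewrite insubT xx'.
Qed.

Lemma low_rle (V : finType) (B : {set V}) :
  B != finset.set0 -> (#|B| < k)%N -> B \in rle [set: V]%SET k.-1.
Proof. by move=> B0 Bk; rewrite inE B0 finset.subsetT/= -ltnS prednK. Qed.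

Lemma weight_extend (V : finType) (T : seq {set V}) (x : point R {set V}) y :
  weight L k T (upd x finset.set0 y) =
  weight L k T (extend_point y (reindex_point (val : {B | B \in rle [set: V]%SET k.-1} -> _) x)).
Proof.
rewrite /weight; apply: eq_bigr => A _.
rewrite (@model_extend _ _ x)//; first exact: low_rle.
by move=> b; rewrite ffunE.
Qed.

Lemma bmeas_weight_extend (V : finType) (T : seq {set V}) y :
  bmeas (fun x => weight L k T (extend_point (Q := rle [set: V]%SET k.-1) y x)).
Proof. exact: (bmeas_comp (measurable_extend y) (bmeas_weight L k T)). Qed.

Lemma fibre_density_extend (V : finType) (E : {set {set V}}) y :
  fibre_density E y = Ex (cube_uniform R {B : {set V} | B \in rle [set: V]%SET k.-1})
    (fun x => weight L k (enum E) (extend_point y x)).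
Proof.
rewrite (Ex_reindex val_inj (bmeas_weight_extend (enum E) y)).
rewrite /fibre_density; apply: (f_equal (Ex _)); apply/funext => x; exact: weight_extend.
Qed.

(** Once the coordinate of the empty set is fixed, the coordinates that matter for the two
    copies of [E] are disjoint. *)
Lemma fibre_density_disjoint_union (V : finType) (E : {set {set V}}) y :
  (forall A, A \in E -> #|A| = k) ->
  fibre_density ([set inl @: A | A : {set V} in E] :|: [set inr @: A | A : {set V} in E])%SET y
  = fibre_density E y ^+ 2 :> R.
Proof.
move=> Ek.
have inl_inj : injective (@inl V V) by move=> ? ? [].
have inr_inj : injective (@inr V V) by move=> ? ? [].
have disj (A B : {set V}) : A != finset.set0 ->
    (@inl V V) @: A <> (@inr V V) @: B.
  case/set0Pn => v vA /setP/(_ (inl v)).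
  by rewrite imset_f// => /esym /imsetP[].
pose I := {B : {set V} | B \in rle [set: V]%SET k.-1}.
rewrite expr2 !(fibre_density_extend E y).
rewrite -(@Ex_independent R _ _ {set (V + V)} (fun b : I => inl @: val b)
  (fun b : I => inr @: val b)); last 2 first.
- exact: bmeas_weight_extend.
- exact: bmeas_weight_extend.
- rewrite /fibre_density; apply: (f_equal (Ex _)); apply/funext => x.
  have hE (e : V -> V + V) : injective e ->
      weight L k (enum [set e @: A | A : {set V} in E]%SET) (upd x finset.set0 y) =
      weight L k (enum E) (extend_point y (reindex_point (fun b : I => e @: val b) x)).
    move=> e_inj; rewrite (weight_natural E _ e_inj) reindex_upd0 weight_extend.
    apply: (f_equal (fun z => weight L k (enum E) (extend_point y z))).
    by apply/ffunP => b; rewrite !ffunE.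
  rewrite -(hE _ inl_inj) -(hE _ inr_inj).
  set E1 := [set inl @: A | A : {set V} in E]%SET.
  set E2 := [set inr @: A | A : {set V} in E]%SET.
  rewrite !weightE -bigU/=; first by apply: eq_bigl => A; rewrite !inE.
  rewrite disjoint_subset; apply/fintype.subsetP => S /imsetP[A AE ->]; rewrite inE.
  apply/negP => /imsetP[B _]; apply: disj.
  by rewrite -card_gt0 (Ek A AE).
- by move=> a b /(imset_inj inl_inj) /val_inj.
- by move=> a b /(imset_inj inr_inj) /val_inj.
- by move=> a b; apply: disj; have := valP a; rewrite inE => /and3P[].
Qed.

(** The first two moments of the fibre density are [density L E] and its square, so its
    variance is zero. *)
Lemma fibre_density_ae (V : finType) (E : {set {set V}}) :
  (forall A, A \in E -> #|A| = k) ->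
  density L ([set inl @: A | A : {set V} in E] :|: [set inr @: A | A : {set V} in E])%SET
  = density L E ^+ 2 ->
  {ae U01 R, forall y, fibre_density E y = density L E}.
Proof.
move=> Ek dis; set dE := density L E.
have bt := bmeas_fibre_density E; have bc := bmeas_cst (T := measurableTypeR R) dE.
have bd := bmeasB bt bc; have bdd := bmeasM bd bd.
have E0 : Ex (U01 R) (fun y => (fibre_density E y - dE) * (fibre_density E y - dE)) = 0.
  rewrite (_ : (fun y => _) = fun y =>
      fibre_density E y ^+ 2 - (2 * dE * fibre_density E y - dE ^+ 2)).
    have btt : bmeas (fun y : measurableTypeR R => fibre_density E y ^+ 2).
      by under eq_fun do rewrite expr2; exact: bmeasM.
    rewrite ExB//; last by apply: bmeasB; [exact: bmeasZ|exact: bmeas_cst].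
    rewrite ExB ?ExZ ?Ex_cst ?Ex_fibre_density//; [|exact: bmeasZ|exact: bmeas_cst].
    under eq_fun do rewrite -fibre_density_disjoint_union//.
    rewrite Ex_fibre_density ?dis -/dE; first by ring.
    have inl_inj : injective (@inl V V) by move=> ? ? [].
    have inr_inj : injective (@inr V V) by move=> ? ? [].
    by move=> A; rewrite inE => /orP[] /imsetP[B /Ek Bk ->]; rewrite card_imset.
  by apply/funext => y; ring.
have := ae_eq0_of_Ex bdd _ E0; move=> /(_ _)/wrap[] //.
  by move=> y; rewrite -expr2 sqr_ge0.
apply: filterS => y /eqP; rewrite mulf_eq0 orbb subr_eq0 => /eqP //.
Qed.

End disintegration.

(** * The hypergraphon *)

Lemma edge_label_inj (k : nat) (F : hypergraph k) (A : edge F) :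
  injective (@edge_label k F A).
Proof. by move=> i j /enum_val_inj /cast_ord_inj. Qed.

Lemma edge_label_imset (k : nat) (F : hypergraph k) (A : edge F) :
  edge_label A @: [set: 'I_k]%SET = val A.
Proof.
apply/eqP; rewrite eqEcard card_imset ?cardsT ?card_ord; last exact: edge_label_inj.
rewrite (edges_card (valP A)) leqnn andbT.
by apply/fintype.subsetP => v /imsetP[i _ ->]; exact: enum_valP.
Qed.

Lemma rproper_setTE (k : nat) (B : {set 'I_k}) :
  (B \in rproper [set: 'I_k]%SET) = (B != finset.set0) && (#|B| < k)%N.
Proof.
rewrite inE finset.properEcard finset.subsetT cardsT card_ord.
by [].
Qed.

Section fibre.
Variables (R : realType) (L : exchangeable_law R) (k : nat).
Hypothesis k_gt0 : (0 < k)%N.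
Variable y : R.

Let Wfun (x : point R (rk k)) : R :=
  bit_prob L [set: 'I_k]%SET 0 (model L k (extend_point (Q := rproper [set: 'I_k]%SET) y x)).

(** By naturality the function on ['I_k] computes the conditional probability of the edge
    [e @: setT] in any vertex set. Taken with permutations of ['I_k] this is the symmetry of the
    hypergraphon, and with the labelling of an edge it is the factor of the density. *)
Lemma Wfun_natural (V : finType) (e : 'I_k -> V) (x : point R (rk k))
    (x' : point R {set V}) : injective e ->
  (forall b : rk k, x b = x' (e @: val b)) ->
  Wfun x = bit_prob L (e @: [set: 'I_k])%SET 0 (model L k (upd x' finset.set0 y)).
Proof.
move=> e_inj xx'; rewrite (bit_prob_model_natural L k _ _ _ e_inj) reindex_upd0.
apply: (f_equal (bit_prob L [set: 'I_k]%SET 0)); apply: model_extend.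
  by move=> B B0 Bk; rewrite rproper_setTE B0.
by move=> b; rewrite ffunE; exact: xx'.
Qed.

Let Wfun_measurable : measurable_fun (@cube R (rk k)) (Wfun : _ -> measurableTypeR R).
Proof.
apply: measurable_funTS; apply: measurable_bit_prob => B i.
exact: (measurableT_comp (mconfig_model L k B i) (measurable_extend y)).
Qed.

Let Wfun_itv (x : point R (rk k)) : cube x -> Wfun x \in `[0, 1].
Proof. by move=> _; rewrite in_itv/=; exact: bit_prob_itv. Qed.

Let Wfun_sym (s : {perm 'I_k}) (x : point R (rk k)) : cube x ->
  Wfun (perm_point s x) = Wfun x.
Proof.
move=> _; pose x' : point R {set 'I_k} := extend_point (Q := rproper [set: 'I_k]%SET) 0 x.
have x'E (b : rk k) : x b = x' (val b).
  rewrite /x' ffunE valK; have := valP b; rewrite inE => /andP[/negbTE -> _].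
  by [].
have h1 (b : rk k) : x b = x' (id @: val b) by rewrite imset_id.
have h2 (b : rk k) : perm_point s x b = x' (s @: val b) by rewrite ffunE x'E.
rewrite (Wfun_natural (fun _ _ => id) h1) (Wfun_natural (@perm_inj _ s) h2).
have -> : s @: [set: 'I_k]%SET = [set: 'I_k]%SET.
  apply/setP => j; rewrite inE; apply/imsetP; exists ((s^-1)%g j) => //.
  by rewrite permKV.
by rewrite imset_id.
Qed.

Definition fibre_hypergraphon : hypergraphon R k :=
  Hypergraphon Wfun_measurable Wfun_itv Wfun_sym.

Lemma cube_uniform_cube (I : finType) :
  measurable (@cube R I) /\ cube_uniform R I (@cube R I) = 1%E.
Proof.
have cE : @cube R I = box (fun=> `[0, 1]%classic).
  by apply/seteqP; split=> x /= h i; have := h i.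
split; first by rewrite cE; apply: measurable_box => i; exact: measurable_itv.
rewrite cE [LHS]cube_uniform_box; last by move=> i; exact: measurable_itv.
apply: big1 => i _; transitivity (\int[lebesgue_measure]_(x in `[0%R, 1%R])
  (uniform_pdf 0%R 1%R x : R)%:E)%E => //.
exact: integral_uniform_pdf1.
Qed.

Lemma density_fibre (F : hypergraph k) :
  hypergraphon_density F fibre_hypergraphon = fibre_density L k (edges F) y.
Proof.
pose g (x : point R (rvert F)) : R :=
  weight L k (enum (edges F)) (extend_point (Q := rle [set: vert F]%SET k.-1) y x).
have bg : bmeas g by exact: bmeas_weight_extend.
have gE (x : point R (rvert F)) :
      \prod_(A : edge F) fibre_hypergraphon (restrict A x) = g x.
  pose x' : point R {set vert F} := extend_point (Q := rle [set: vert F]%SET k.-1) 0 x.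
  have x'E (b : rvert F) : x b = x' (val b).
    rewrite /x' ffunE valK; have := valP b; rewrite inE => /and3P[/negbTE -> _ _].
    by [].
  transitivity (\prod_(A : edge F)
      bit_prob L (val A) 0 (model L k (upd x' finset.set0 y))).
    apply: eq_bigr => A _; rewrite -edge_label_imset.
    apply: Wfun_natural; first exact: edge_label_inj.
    by move=> b; rewrite ffunE x'E.
  rewrite /g weightE (@model_extend _ L k _ _ x'); last 2 first.
  - by move=> B; exact: low_rle.
  - exact: x'E.
  rewrite -big_enum -[in RHS]big_enum /= -(big_map val predT (fun A =>
    bit_prob L A 0 (model L k (upd x' finset.set0 y)))).
  apply: perm_big; apply: uniq_perm; rewrite ?enum_uniq//.
    by rewrite map_inj_uniq ?enum_uniq//; exact: val_inj.
  move=> A; rewrite mem_enum; apply/mapP/idP => [[b _ ->]|AF]; first exact: valP.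
  by exists (Sub A AF); rewrite ?mem_enum ?SubK.
have [mc c1] := cube_uniform_cube (rvert F).
rewrite (fibre_density_extend L k_gt0) -[RHS](Ex_full mc c1 bg).
rewrite /hypergraphon_density Rintegral_mkcond /Ex; congr Rintegral.
apply/funext => x; rewrite patchE -gE; by case: (x \in _); rewrite ?mul1r ?mul0r.
Qed.

End fibre.

Lemma density_dissociated (R : realType) (k : nat) (H : nat -> hypergraph k)
    (vert_gt0 : forall n, (0 < #|vert (H n)|)%N) (cvgH : convergent R H)
    (F : hypergraph k) (L := limit_law vert_gt0 cvgH) :
  density L ([set inl @: A | A : {set vert F} in edges F] :|:
             [set inr @: A | A : {set vert F} in edges F])%SET
  = density L (edges F) ^+ 2.
Proof.
rewrite -limit_law_dissociated /density; apply: eq_bigl => T.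
rewrite finset.subUset; apply/andP/forall_inP => [[hl hr] A AF|h].
  apply/andP; split; [move/fintype.subsetP: hl|move/fintype.subsetP: hr];
    by apply; exact: imset_f.
by split; apply/fintype.subsetP => _ /imsetP[A /h /andP[? ?] ->].
Qed.

Theorem theorem1p5 (R : realType) (k : nat) (k_gt0 : (0 < k)%N)
    (H : nat -> hypergraph k) (vert_gt0 : forall n, (0 < #|vert (H n)|)%N) :
  convergent R H ->
  exists W : hypergraphon R k,
    forall F : hypergraph k,
      (fun n => hom_density R F (H n)) @ \oo --> hypergraphon_density F W.
Proof.
move=> cvgH; pose L := limit_law vert_gt0 cvgH.
pose good (p : {n : nat & {set {set 'I_n}}}) (y : R) : Prop :=
  (forall A, A \in tagged p -> #|A| = k) ->
  fibre_density L k (tagged p) y = density L (tagged p).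
have good_ae p : {ae U01 R, forall y, good p y}.
  have [/forall_inP/= hE|nE] := boolP [forall A in tagged p, #|A| == k]; last first.
    apply: aeW => y hE; have /negP[] := nE; apply/forall_inP => A AE.
    by rewrite hE.
  have hE' A : A \in tagged p -> #|A| = k by move=> /hE /eqP.
  have := fibre_density_ae k_gt0 hE' (density_dissociated vert_gt0 cvgH (Hypergraph hE')).
  apply: (@filterS _ _ (ae_filter_ringOfSetsType (U01 R))) => y ty.
  by move=> _.
(* The finite hypergraphs on initial segments are enumerated by their codes m. *)
have [y hy] : exists y, forall m,
    if choice.unpickle m is Some p then good p y else True.
  apply: (@ae_exists _ _ _ (U01 R)); apply: ae_foralln => m.
  by case: (choice.unpickle m) => [p|]; [exact: good_ae|exact: aeW].
exists (fibre_hypergraphon L k y) => F.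
rewrite (density_fibre L k_gt0).
suff -> : fibre_density L k (edges F) y = density L (edges F) by exact: cvg_hom_density.
(* Transport F to an isomorphic hypergraph in the countable family. *)
pose e : 'I_#|vert F| -> vert F := enum_val.
have e_inj : injective e by exact: enum_val_inj.
pose E := [set (e @^-1: A) | A : {set vert F} in edges F]%SET.
have eK (A : {set vert F}) : e @: (e @^-1: A) = A.
  apply/setP => v; apply/imsetP/idP => [[i + ->]|vA]; first by rewrite inE.
  by exists (enum_rank v); rewrite ?inE /e enum_rankK.
have EF : [set e @: A | A : {set 'I_#|vert F|} in E]%SET = edges F.
  rewrite /E -imset_comp -[RHS]imset_id; apply: finset.eq_imset => A /=; exact: eK.
have Ek A : A \in E -> #|A| = k.
  by move=> /imsetP[B /edges_card Bk ->]; move: Bk; rewrite -{1}(eK B) card_imset.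
have := hy (choice.pickle (Tagged (fun n => {set {set 'I_n}}) E)).
rewrite choice.pickleK => /(_ Ek) /= tE.
have dE : density L (edges F) = density L E.
  have Fk A : A \in edges F -> #|A| = k by exact: edges_card.
  rewrite -(Ex_fibre_density L Fk) -(Ex_fibre_density L Ek) -EF.
  by congr Ex; apply/funext => z; exact: fibre_density_natural.
by rewrite dE -tE -EF; exact: fibre_density_natural.
Qed.
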